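(* Let $\mathbb{K}=\mathbb{R}$ or $\mathbb{C}$, let $m\geq 2$ be an integer and let $\sigma:\{1,\dots,m\}\to\{1,\dots,m\}$ be a bijection. Let $(q_1,\dots,q_{m-1})\in(0,\infty]^{m-1}$ and $(p_1,\dots,p_m)\in[1,\infty]^m$. The following assertions are equivalent: (1) There is a constant $C_{p_1,\dots,p_m}\geq 1$ such that $$\left(\sum_{j_{\sigma(1)}=1}^{\infty}\left(\sum_{j_{\sigma(2)}=1}^{\infty}\cdots\left(\sum_{j_{\sigma(m)}=1}^{\infty}\left|A(e_{j_1},\dots,e_{j_m})\right|^{p_{\sigma(m)}^{*}}\right)^{\frac{q_{m-1}}{p_{\sigma(m)}^{*}}}\cdots\right)^{\frac{q_1}{q_2}}\right)^{\frac{1}{q_1}}\leq C_{p_1,\dots,p_m}\|A\|$$ for all continuous $m$-linear forms $A:X_{p_1}\times\cdots\times X_{p_m}\to\mathbb{K}$. (2) The exponents $q_1,\dots,q_{m-1}$ satisfy $$q_1\geq\delta^{p_{\sigma(1)},\dots,p_{\sigma(m-1)},\mu},\quad q_2\geq\delta^{p_{\sigma(2)},\dots,p_{\sigma(m-1)},\mu},\quad\dots,\quad q_{m-1}\geq\delta^{p_{\sigma(m-1)},\mu},$$ where $\mu=\min\{p_{\sigma(m)},2\}$.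
   Context: For $p\in[1,\infty)$, $X_p:=\ell_p$ (scalar sequences over $\mathbb{K}$), and $X_\infty:=c_0$ with the supremum norm; $e_j$ denotes the $j$-th canonical unit vector. The norm of a continuous $m$-linear form is $\|A\|=\sup\{|A(x_1,\dots,x_m)|:\|x_k\|\le 1 \text{ for all } k\}$. The conjugate index $s^*$ of $s\in[1,\infty]$ is defined by $1/s+1/s^*=1$. Conventions: $1/0=\infty$, $1/\infty=0$; whenever an exponent $q$ equals $\infty$, the expression $(\sum_j |x_j|^q)^{1/q}$ means $\sup_j|x_j|$. The nested expression in (1) is the iterated mixed norm: with the other indices fixed, first take the $\ell_{p_{\sigma(m)}^*}$-norm in the index $j_{\sigma(m)}$, then the $\ell_{q_{m-1}}$-(quasi-)norm in $j_{\sigma(m-1)}$ of the result, and so on, ending with the $\ell_{q_1}$-(quasi-)norm in $j_{\sigma(1)}$. For $s_k,\dots,s_n\in[1,\infty]$, $$\delta^{s_k,\dots,s_n}:=\frac{1}{\max\left\{1-\left(\frac{1}{s_k}+\cdots+\frac{1}{s_n}\right),0\right\}},$$ so $\delta^{s_k,\dots,s_n}=\infty$ when $1/s_k+\cdots+1/s_n\geq 1$. *)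

(* Defs.v *)
From HB Require Import structures.
From mathcomp Require Import all_boot all_order all_fingroup all_algebra.
From mathcomp Require Import all_classical all_reals all_analysis.
From mathcomp.real_closed Require Import complex.

Set Implicit Arguments.
Unset Strict Implicit.
Unset Printing Implicit Defensive.
Import Order.TTheory GRing.Theory Num.Theory.
Import numFieldNormedType.Exports.

Local Open Scope classical_set_scope.
Local Open Scope ring_scope.

(* The scalar field is a ring K together with a real-valued modulus
   absK : K -> R; it is instantiated with (R, `|_|) and with the complex
   numbers (R[i], normc).  The norm `|_| of R[i] is not used because it takes
   its values in R[i]. *)

Definition lnorm (R : realType) (p : \bar R) (f : nat -> \bar R) : \bar R :=
  'N[@counting nat R]_p[f]%E.

Definition seqnorm (R : realType) (K : nzRingType) (absK : K -> R)
    (p : \bar R) (x : nat -> K) : \bar R :=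
  lnorm p (fun j => (absK (x j))%:E).

Definition Xspace (R : realType) (K : nzRingType) (absK : K -> R)
    (p : \bar R) : set (nat -> K) :=
  [set x | if p == +oo%E then (fun j => absK (x j)) @ \oo --> (0 : R)
           else (seqnorm absK p x < +oo)%E].

Definition unit_vec (K : nzRingType) (j : nat) : nat -> K :=
  fun l => (l == j)%:R.

(* Forms on X_(p 0) x ... x X_(p (m-1)) are total functions on families of
   sequences; all notions below only involve their values on this product. *)
Definition Xprod (R : realType) (K : nzRingType) (absK : K -> R) (m : nat)
    (p : 'I_m -> \bar R) : set ('I_m -> nat -> K) :=
  [set x | forall k, Xspace absK (p k) (x k)].

Definition multilinear_form (R : realType) (K : nzRingType) (absK : K -> R)
    (m : nat) (p : 'I_m -> \bar R) (A : ('I_m -> nat -> K) -> K) : Prop :=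
  forall (x : 'I_m -> nat -> K) (k : 'I_m) (a : K) (u v : nat -> K),
    Xprod absK p x -> Xspace absK (p k) u -> Xspace absK (p k) v ->
    A (@dfwith 'I_m (fun=> nat -> K) x k (fun j => a * u j + v j)) =
    a * A (@dfwith 'I_m (fun=> nat -> K) x k u) +
    A (@dfwith 'I_m (fun=> nat -> K) x k v).

Definition continuous_form (R : realType) (K : nzRingType) (absK : K -> R)
    (m : nat) (p : 'I_m -> \bar R) (A : ('I_m -> nat -> K) -> K) : Prop :=
  forall x, Xprod absK p x -> forall eps : R, 0 < eps ->
  exists2 delta : R, 0 < delta &
    forall y, Xprod absK p y ->
      (forall k, (seqnorm absK (p k) (fun j => y k j - x k j)%R < delta%:E)%E) ->
      absK (A y - A x) < eps.

Definition form_norm (R : realType) (K : nzRingType) (absK : K -> R)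
    (m : nat) (p : 'I_m -> \bar R) (A : ('I_m -> nat -> K) -> K) : \bar R :=
  ereal_sup [set (absK (A x))%:E | x in
    [set x | Xprod absK p x /\ forall k, (seqnorm absK (p k) (x k) <= 1)%E]].

(* mixed_norm [:: r_1; ...; r_m] a is the l_(r_1)-norm in j_1 of the
   l_(r_2)-norm in j_2 of ... of the l_(r_m)-norm in j_m of
   a [:: j_1; ...; j_m]. *)
Fixpoint mixed_norm (R : realType) (r : seq (\bar R)) (a : seq nat -> \bar R)
    : \bar R :=
  if r is r1 :: r' then
    lnorm r1 (fun j => mixed_norm r' (fun s => a (j :: s)))
  else a [::].

(* |A(e_(j_1), ..., e_(j_m))| as a function of the list
   js = [:: j_(sigma 1); ...; j_(sigma m)]: the index j_k is the entry of js
   at position sigma^-1 k. *)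
Definition form_coef (R : realType) (K : nzRingType) (absK : K -> R)
    (m : nat) (sigma : {perm 'I_m}) (A : ('I_m -> nat -> K) -> K)
    (js : seq nat) : \bar R :=
  (absK (A (fun k => unit_vec K (nth 0%N js ((sigma^-1)%g k)))))%:E.

(* The number m of variables is n.+1, so that there are n = m - 1 exponents q
   and sigma(m) is sigma ord_max. *)
Definition anisotropic_ineq (R : realType) (K : nzRingType) (absK : K -> R)
    (n : nat) (sigma : {perm 'I_n.+1}) (q : 'I_n -> \bar R)
    (p : 'I_n.+1 -> \bar R) : Prop :=
  exists2 C : R, 1 <= C &
    forall A : ('I_n.+1 -> nat -> K) -> K,
      multilinear_form absK p A -> continuous_form absK p A ->
      (mixed_norm (rcons [seq q i | i <- enum 'I_n]
                         (hoelder_conjugate (p (sigma ord_max))))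
                  (form_coef absK sigma A)
       <= C%:E * form_norm absK p A)%E.

(* The inverse on \bar R satisfies 0^-1 = +oo and +oo^-1 = 0. *)
Definition delta (R : realType) (s : seq (\bar R)) : \bar R :=
  ((maxe (1 - \sum_(t <- s) t^-1) 0)^-1)%E.

Definition exponent_condition (R : realType) (n : nat)
    (sigma : {perm 'I_n.+1}) (q : 'I_n -> \bar R) (p : 'I_n.+1 -> \bar R)
    : Prop :=
  forall i : 'I_n,
    (delta (rcons [seq p (sigma (widen_ord (leqnSn n) k))
                  | k : 'I_n <- enum 'I_n & (i <= k)%N]
                  (mine (p (sigma ord_max)) 2%:E)) <= q i)%E.

(* Main.v *)
Require Import Defs.
From mathcomp Require Import all_boot all_order all_fingroup all_algebra.
From mathcomp Require Import all_classical all_reals all_analysis ess_sup_inf.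
From mathcomp.real_closed Require Import complex.
From mathcomp Require Import ring lra.

(* After renumbering the variables by [sigma], view a form of norm at most 1 as
   an operator on the first m - 1 variables with values in the dual of X_(p_m).

   Sufficiency. It is enough to treat q_i = delta(p_i, ..., p_(m-1), mu). The
   space of arrays in the indices j_(i+1), ..., j_m, with its mixed norm, has
   Rademacher cotype c = q_(i+1) (for i = m - 1: the dual of X_(p_m) has cotype
   mu^*, by Khinchine's and Minkowski's inequalities). If t_j is the mixed norm
   of the array obtained by fixing e_j in the i-th slot, averaging over signs
   gives sum_j (a_j t_j)^c <= C for all weights a in the unit ball of
   X_(p_i); dualizing, t lies in l_r with 1/r = 1/c - 1/p_i, that is r = q_i.
   One concludes by induction on the number of variables, on finite
   truncations.

   Necessity. Freezing the first i - 1 variables at e_0, test the inequality on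
   the forms sum_(j, l < N) h_(jl) x_i(j) ... x_(m-1)(j) x_m(l), where h is the
   identity matrix if p_m <= 2 and a Hadamard matrix if p_m >= 2. Their norms are
   estimated by the weighted AM-GM inequality, and N -> oo gives the condition
   on q_i. *)

Set Implicit Arguments.
Unset Strict Implicit.
Unset Printing Implicit Defensive.
Import numFieldNormedType.Exports.
Import Order.TTheory GRing.Theory Num.Theory.

Local Open Scope ring_scope.

(** * Inequalities for real powers *)

Section PowerInequalities.
Context {R : realType}.
Implicit Types a b c x y t u : R.

Lemma ler_powRl c x y : 0 <= c -> 0 <= x -> x <= y -> x `^ c <= y `^ c.
Proof.
move=> c0 x0 xy; apply: ge0_ler_powR => //; rewrite nnegrE //.
exact: le_trans xy.
Qed.

Lemma ler_powRlP c x y : 0 < c -> 0 <= x -> 0 <= y ->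
  (x `^ c <= y `^ c) = (x <= y).
Proof.
move=> c0 x0 y0; apply/idP/idP; last exact: ler_powRl (ltW c0) x0.
apply: contraTT; rewrite -!ltNge => yx.
by apply: gt0_ltr_powR => //; rewrite nnegrE.
Qed.

Lemma powRK c x : c != 0 -> 0 <= x -> (x `^ c) `^ c^-1 = x.
Proof. by move=> c0 x0; rewrite -powRrM divff// powRr1. Qed.

Lemma powRVK c x : c != 0 -> 0 <= x -> (x `^ c^-1) `^ c = x.
Proof. by move=> c0 x0; rewrite -powRrM mulVf// powRr1. Qed.

Lemma powR_le_expR x c : 0 <= x -> 0 <= c -> x `^ c <= expR (c * (x - 1)).
Proof.
rewrite le_eqVlt => /predU1P[<- c0|x0 c0].
  have [->|cN0] := eqVneq c 0; first by rewrite powRr0 mul0r expR0.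
  by rewrite powR0// expR_ge0.
rewrite /powR gt_eqF// ler_expR ler_wpM2l//.
have := @le_ln1Dx R (x - 1); rewrite [1 + _]addrC subrK; apply; lra.
Qed.

(** Dividing each [f i] by the mean reduces this to x^w <= exp(w (x - 1)), and the exponents then
    add up to at most 0. The slack [e] keeps the divisor positive when the mean is 0. *)
Lemma weighted_amgm (I : Type) (r : seq I) (w f : I -> R) :
  (forall i, 0 <= w i) -> (forall i, 0 <= f i) -> \sum_(i <- r) w i = 1 ->
  \prod_(i <- r) f i `^ w i <= \sum_(i <- r) w i * f i.
Proof.
move=> w0 f0 w1; apply/ler_addgt0Pr => e e0.
set S := \sum_(i <- r) w i * f i.
have S0 : 0 <= S by apply: sumr_ge0 => i _; apply: mulr_ge0.
have T0 : 0 < S + e by rewrite ltr_wpDl.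
have -> : \prod_(i <- r) f i `^ w i =
    (S + e) * \prod_(i <- r) (f i / (S + e)) `^ w i.
  have {1}<- : \prod_(i <- r) (S + e) `^ w i = S + e.
    by rewrite /powR gt_eqF// -expR_sum -mulr_suml w1 mul1r lnK.
  rewrite -big_split /=; apply: eq_bigr => i _.
  rewrite -powRM ?(ltW T0)//; last by rewrite divr_ge0// ltW.
  by rewrite mulrCA divff ?mulr1// gt_eqF.
rewrite -[leRHS]mulr1 ler_wpM2l ?(ltW T0)//.
apply: (@le_trans _ _ (\prod_(i <- r) expR (w i * (f i / (S + e) - 1)))).
  apply: ler_prod => i _; rewrite powR_ge0/=.
  by apply: powR_le_expR => //; rewrite divr_ge0// ltW.
rewrite -expR_sum -[leRHS]expR0 ler_expR.
have -> : \sum_(i <- r) w i * (f i / (S + e) - 1) = S / (S + e) - 1.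
  rewrite -[X in _ = _ - X]w1 /S mulr_suml -sumrB; apply: eq_bigr => i _.
  by rewrite mulrBr mulr1 mulrA.
rewrite subr_le0 ler_pdivrMr// mul1r; lra.
Qed.

(** AM-GM with weights 1/c and 1 - 1/c. For fixed [y] it says that x^c lies above its tangent at
    [y], which is how convexity of the power enters below. *)
Lemma young_powR c x y : 1 <= c -> 0 <= x -> 0 <= y ->
  x * y `^ (c - 1) <= c^-1 * x `^ c + (1 - c^-1) * y `^ c.
Proof.
move=> c1 x0 y0; have c0 : 0 < c by lra.
have cV : c^-1 <= 1 by rewrite invf_le1.
have := @weighted_amgm bool [:: true; false]
  (fun z => if z then c^-1 else 1 - c^-1) (fun z => if z then x `^ c else y `^ c).
have big2 (V : Type) (idx : V) (op : Monoid.law idx) (F : bool -> V) :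
    \big[op/idx]_(z <- [:: true; false]) F z = op (F true) (F false).
  by rewrite big_cons big_seq1.
rewrite !big2 /=.
rewrite (powRK (lt0r_neq0 c0) x0) -powRrM mulrBr mulr1.
rewrite (divff (lt0r_neq0 c0)); apply.
- by case; rewrite ?subr_ge0// invr_ge0 ltW.
- by case; rewrite powR_ge0.
- lra.
Qed.

Lemma powR_mulB1 c x : 1 <= c -> 0 <= x -> x `^ c = x * x `^ (c - 1).
Proof. by move=> c1 x0; rewrite mulr_powRB1//; lra. Qed.

Lemma powR_mid c x y : 1 <= c -> 0 <= x -> 0 <= y ->
  ((x + y) / 2) `^ c <= (x `^ c + y `^ c) / 2.
Proof.
move=> c1 x0 y0; set m := (x + y) / 2.
have m0 : 0 <= m by rewrite /m; lra.
have hx := young_powR c1 x0 m0; have hy := young_powR c1 y0 m0.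
have hm : m `^ c *+ 2 = x * m `^ (c - 1) + y * m `^ (c - 1).
  rewrite (powR_mulB1 c1 m0) -mulrDl -mulrnAl; congr (_ * _).
  by rewrite /m -mulr_natr divfK ?pnatr_eq0.
have c0 : 0 < c^-1 by rewrite invr_gt0; lra.
rewrite -(ler_pM2l c0); move: hm; rewrite mulr2n; lra.
Qed.

Lemma powR_superadd c x y : 1 <= c -> 0 <= x -> 0 <= y ->
  x `^ c + y `^ c <= (x + y) `^ c.
Proof.
move=> c1 x0 y0; rewrite !(powR_mulB1 c1)// ?addr_ge0// mulrDl.
by apply: lerD; rewrite ler_wpM2l// ler_powRl//; lra.
Qed.

Lemma sum_powR_superadd (I : Type) (r : seq I) (P : pred I) c (f : I -> R) :
  1 <= c -> (forall i, 0 <= f i) ->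
  \sum_(i <- r | P i) f i `^ c <= (\sum_(i <- r | P i) f i) `^ c.
Proof.
move=> c1 f0; elim: r => [|i r IH]; first by rewrite !big_nil powR_ge0.
rewrite !big_cons; case: ifP => // _; apply: le_trans (powR_superadd c1 _ _) => //.
  by rewrite lerD2l.
exact: sumr_ge0.
Qed.

(** Superadditivity of the power [d / c >= 1], applied to the terms already raised to the power
    [c]. *)
Lemma powR_sum_le (I : Type) (r : seq I) (P : pred I) c d (f : I -> R) :
  0 < c -> c <= d -> (forall i, 0 <= f i) ->
  (\sum_(i <- r | P i) f i `^ d) `^ d^-1 <= (\sum_(i <- r | P i) f i `^ c) `^ c^-1.
Proof.
move=> c0 cd f0; have d0 : 0 < d by lra.
have := @sum_powR_superadd I r P (d / c) (fun i => f i `^ c).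
have dc1 : 1 <= d / c by rewrite ler_pdivlMr// mul1r.
move=> /(_ dc1 (fun=> powR_ge0 _ _)).
under eq_bigr do rewrite -powRrM mulrCA divff ?gt_eqF// mulr1.
move=> /(@ler_powRl d^-1 _ _ _ _) h.
apply: le_trans (h _ _) _; [by rewrite invr_ge0 ltW| |].
  by apply: sumr_ge0 => i _; apply: powR_ge0.
by rewrite -powRrM mulrAC divff ?gt_eqF// mul1r.
Qed.

(** Average the tangent bounds of [young_powR] at the mean [m]: the left-hand sides add up to
    m^c. *)
Lemma jensen_powR (I : Type) (r : seq I) c (w f : I -> R) : 1 <= c ->
  (forall i, 0 <= w i) -> (forall i, 0 <= f i) -> \sum_(i <- r) w i = 1 ->
  (\sum_(i <- r) w i * f i) `^ c <= \sum_(i <- r) w i * f i `^ c.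
Proof.
move=> c1 w0 f0 w1; set m := \sum_(i <- r) w i * f i.
have m0 : 0 <= m by apply: sumr_ge0 => i _; apply: mulr_ge0.
have : \sum_(i <- r) w i * (f i * m `^ (c - 1)) <=
    \sum_(i <- r) w i * (c^-1 * f i `^ c + (1 - c^-1) * m `^ c).
  by apply: ler_sum => i _; rewrite ler_wpM2l// young_powR.
under eq_bigr do rewrite mulrA.
under [in X in _ <= X]eq_bigr do rewrite mulrDr mulrCA.
rewrite -mulr_suml -/m -powR_mulB1// big_split /= -mulr_sumr -mulr_suml w1.
have c0 : 0 < c^-1 by rewrite invr_gt0; lra.
move=> h; rewrite -(ler_pM2l c0); lra.
Qed.

Lemma minkowski_sum (I J : Type) (r : seq I) (s : seq J) c (v : I -> J -> R) :
  1 <= c -> (forall i j, 0 <= v i j) ->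
  (\sum_(j <- s) (\sum_(i <- r) v i j) `^ c) `^ c^-1 <=
  \sum_(i <- r) (\sum_(j <- s) v i j `^ c) `^ c^-1.
Proof.
move=> c1 v0; have c0 : 0 < c by lra.
have cN : c != 0 by rewrite gt_eqF.
case: r => [|i0 r0].
  rewrite !big_nil big1 ?powR0 ?invr_neq0// => j _.
  by rewrite big_nil powR0.
set r := i0 :: r0; set V := fun i => (\sum_(j <- s) v i j `^ c) `^ c^-1.
have V0 i : 0 <= V i by apply: powR_ge0.
(* Spreading [e] evenly over the nonempty list [r] makes every [W i] positive, so that one can
   divide by it. *)
apply/ler_addgt0Pr => e e0; set d := e / (size r)%:R.
have d0 : 0 < d by rewrite divr_gt0// ltr0n.
pose W i := V i + d; have W0 i : 0 < W i by rewrite /W ltr_wpDl.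
have -> : \sum_(i <- r) V i + e = \sum_(i <- r) W i.
  rewrite big_split /=; congr (_ + _).
  by rewrite big_const_seq count_predT iter_addr_0 -mulr_natr divfK ?pnatr_eq0.
set T := \sum_(i <- r) W i.
(* [\sum_i v i j] is [T] times the average of the [v i j / W i] with weights
   [W i / T]: Jensen's inequality and summation over [j] give the bound. *)
have T0 : 0 < T.
  by rewrite /T /r big_cons ltr_wpDr// sumr_ge0// => i _; apply: ltW.
rewrite -[leRHS](powRK cN (ltW T0)) ler_powRl ?invr_ge0 ?(ltW c0)//.
  by apply: sumr_ge0 => j _; apply: powR_ge0.
apply: (@le_trans _ _ (\sum_(j <- s) \sum_(i <- r)
    (W i / T) * (T `^ c * (v i j `^ c / W i `^ c)))).
  apply: ler_sum => j _.
  have := @jensen_powR I r c (fun i => W i / T) (fun i => T * (v i j / W i)) c1.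
  have -> : \sum_(i <- r) W i / T * (T * (v i j / W i)) = \sum_(i <- r) v i j.
    apply: eq_bigr => i _; field; rewrite !gt_eqF//.
  have -> : \sum_(i <- r) W i / T * (T * (v i j / W i)) `^ c =
     \sum_(i <- r) (W i / T) * (T `^ c * (v i j `^ c / W i `^ c)).
    apply: eq_bigr => i _; congr (_ * _).
    rewrite powRM ?divr_ge0 ?(ltW T0) ?(ltW (W0 _))//; congr (_ * _).
    by rewrite powRM ?invr_ge0 ?(ltW (W0 _))// -powR_inv1 ?(ltW (W0 _))//
      -powRrM mulN1r powRN.
  apply.
  - by move=> i; rewrite divr_ge0// ltW.
  - by move=> i; rewrite mulr_ge0 ?divr_ge0// ltW.
  - by rewrite -mulr_suml divff// gt_eqF.
rewrite exchange_big /=.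
apply: (@le_trans _ _ (\sum_(i <- r) (W i / T) * T `^ c)).
  apply: ler_sum => i _; rewrite -mulr_sumr ler_wpM2l ?divr_ge0 ?(ltW T0) ?(ltW (W0 _))//.
  rewrite -mulr_sumr -mulr_suml ler_piMr ?powR_ge0//.
  rewrite ler_pdivrMr ?powR_gt0// mul1r.
  rewrite -[leLHS](powRVK cN) ?ler_powRl ?(ltW c0) ?powR_ge0//; last first.
    by apply: sumr_ge0 => j _; apply: powR_ge0.
  by rewrite /W lerDl ltW.
by rewrite -mulr_suml -mulr_suml divff ?mul1r// gt_eqF.
Qed.
End PowerInequalities.

(** * Sign averages *)

(* [radE N y G] is the expectation of [G (\sum_(j < N) eps_j y_j)] for
   independent uniform signs [eps_j]. *)
Fixpoint radE (R : realType) (V : zmodType) (N : nat) (y : nat -> V)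
    (G : V -> R) : R :=
  if N is N'.+1 then
    (radE N' y (fun v => G (v + y N')) + radE N' y (fun v => G (v - y N'))) / 2
  else G 0.

Section Rademacher.
Context {R : realType}.

Section Averages.
Context {V : zmodType}.
Implicit Types (N : nat) (y : nat -> V) (G H : V -> R).

Lemma eq_radE N y G H : G =1 H -> radE N y G = radE N y H.
Proof.
elim: N G H => [|N IH] G H GH /=; first exact: GH.
by congr ((_ + _) / _); apply: IH => v; exact: GH.
Qed.

Lemma ler_radE N y G H : (forall v, G v <= H v) -> radE N y G <= radE N y H.
Proof.
elim: N G H => [|N IH] G H GH /=; first exact: GH.
by rewrite ler_pM2r// lerD// IH.
Qed.

Lemma radE_cst N y (c : R) : radE N y (fun=> c) = c.
Proof. by elim: N => //= N ->; lra. Qed.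

Lemma radE_ge0 N y G : (forall v, 0 <= G v) -> 0 <= radE N y G.
Proof. by move=> G0; rewrite -(radE_cst N y 0) ler_radE. Qed.

Lemma radED N y G H :
  radE N y (fun v => G v + H v) = radE N y G + radE N y H.
Proof.
elim: N G H => [//|N IH] G H /=.
rewrite (IH (fun v => G (v + y N)) (fun v => H (v + y N))).
rewrite (IH (fun v => G (v - y N)) (fun v => H (v - y N))); lra.
Qed.

Lemma radEZ N y c G : radE N y (fun v => c * G v) = c * radE N y G.
Proof.
elim: N G => [//|N IH] G /=.
rewrite (IH (fun v => G (v + y N))) (IH (fun v => G (v - y N))); lra.
Qed.

Lemma radE_sum (I : Type) (r : seq I) N y (G : I -> V -> R) :
  radE N y (fun v => \sum_(i <- r) G i v) = \sum_(i <- r) radE N y (G i).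
Proof.
elim: r => [|i r IH].
  rewrite big_nil -[RHS](radE_cst N y); apply: eq_radE => v; exact: big_nil.
rewrite big_cons -IH -radED; apply: eq_radE => v; exact: big_cons.
Qed.

Lemma radE_powR c N y G : 1 <= c -> (forall v, 0 <= G v) ->
  radE N y G `^ c <= radE N y (fun v => G v `^ c).
Proof.
move=> c1; elim: N G => [//|N IH] G G0 /=.
apply: le_trans (powR_mid c1 _ _) _; try exact: radE_ge0.
by rewrite ler_pM2r// lerD// IH.
Qed.

Lemma radE_le N y G D :
  (forall e : nat -> bool, G (\sum_(j < N) (if e j then - y j else y j)) <= D) ->
  radE N y G <= D.
Proof.
elim: N G => [|N IH] G h /=; first by have := h xpredT; rewrite big_ord0.
have sgn b : radE N y (fun v => G (v + (if b then - y N else y N))) <= D.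
  apply: IH => e; have := h (fun j => if j == N then b else e j).
  rewrite big_ord_recr /= eqxx; congr (G (_ + _) <= D).
  by apply: eq_bigr => j _; rewrite ltn_eqF.
have := sgn false; have := sgn true => /=; lra.
Qed.
End Averages.

Lemma radE_comp (V W : zmodType) N (y : nat -> V) (phi : V -> W) (G : W -> R) :
  phi 0 = 0 -> (forall u v, phi (u + v) = phi u + phi v) ->
  (forall u, phi (- u) = - phi u) ->
  radE N y (fun v => G (phi v)) = radE N (fun j => phi (y j)) G.
Proof.
move=> p0 pD pN; elim: N G => [|N IH] G /=; first by rewrite p0.
rewrite -!IH; congr ((_ + _) / _); apply: eq_radE => v; rewrite pD ?pN//.
Qed.

(** The offset [t] lets the induction run: the last sign moves it by [a N] in either direction, and
    the cross terms cancel. *)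
Lemma radE_sqr N (a : nat -> R) (t : R) :
  radE N a (fun x => (x + t) ^+ 2) = t ^+ 2 + \sum_(j < N) a j ^+ 2.
Proof.
elim: N t => [|N IH] t /=; first by rewrite add0r big_ord0 addr0.
under eq_radE do rewrite -addrA.
under [in X in _ + X]eq_radE do rewrite -addrA.
rewrite !IH big_ord_recr /=; set S := \sum_(j < N) _. lra.
Qed.

(** Same induction as for the second moment; twice the new bound exceeds the sum of the two old ones
    by exactly [4 * a N ^+ 4]. *)
Lemma radE_fourth N (a : nat -> R) (t : R) : let S := \sum_(j < N) a j ^+ 2 in
  radE N a (fun x => (x + t) ^+ 4) <= t ^+ 4 + 6 * t ^+ 2 * S + 3 * S ^+ 2.
Proof.
elim: N t => [|N IH] t /=.
  by rewrite add0r big_ord0 expr0n mulr0 mulr0 !addr0.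
under eq_radE do rewrite -addrA.
under [in X in _ + X]eq_radE do rewrite -addrA.
have /= h1 := IH (a N + t); have /= h2 := IH (- a N + t).
rewrite big_ord_recr /=; set S := \sum_(j < N) _ in h1 h2 *.
have a4 : 0 <= a N ^+ 4 by rewrite (_ : 4 = 2 * 2)%N// exprM sqr_ge0.
rewrite ler_pdivrMr//; apply: le_trans (lerD h1 h2) _.
rewrite -subr_ge0.
have -> : (t ^+ 4 + 6 * t ^+ 2 * (S + a N ^+ 2) + 3 * (S + a N ^+ 2) ^+ 2) * 2 -
  ((a N + t) ^+ 4 + 6 * (a N + t) ^+ 2 * S + 3 * S ^+ 2 +
   ((- a N + t) ^+ 4 + 6 * (- a N + t) ^+ 2 * S + 3 * S ^+ 2)) = 4 * a N ^+ 4.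
  by ring.
lra.
Qed.

(* In expectation, bounds a second moment by an [s]-th moment and a fourth
   moment of negligible weight once [l] is large. *)
Lemma powR_interp s l t : 0 < s <= 2 -> 0 < l -> 0 <= t ->
  t ^+ 2 <= l `^ (2 - s) * t `^ s + t ^+ 4 / l ^+ 2 :> R.
Proof.
move=> /andP[s0 s2] l0 t0; have [tl|lt] := lerP t l.
  apply: (@le_trans _ _ (l `^ (2 - s) * t `^ s)); last first.
    by rewrite lerDl divr_ge0 ?exprn_ge0// ltW.
  rewrite -powR_mulrn// (_ : 2%:R = (2 - s) + s); last by rewrite subrK.
  rewrite powRD ?subrK ?pnatr_eq0//.
  by rewrite ler_wpM2r ?powR_ge0// ler_powRl// subr_ge0.
apply: (@le_trans _ _ (t ^+ 4 / l ^+ 2)); last first.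
  by rewrite lerDr mulr_ge0 ?powR_ge0.
rewrite ler_pdivlMr ?exprn_gt0// (_ : 4 = 2 + 2)%N// exprD.
by rewrite ler_wpM2l ?exprn_ge0// ler_sqr ?nnegrE ?(ltW l0) ?(ltW lt).
Qed.
End Rademacher.

(* What the real and the complex modulus have in common; [emb] embeds the
   reals into the scalars, [re] and [im] are the real coordinates. *)
Record modulus (R : realType) (K : comNzRingType) (absK : K -> R)
    (emb : {rmorphism R -> K}) (re im : K -> R) : Prop := Modulus {
  modM : forall x y, absK (x * y) = absK x * absK y;
  mod_le : forall x y, absK (x + y) <= absK x + absK y;
  mod_emb : forall t, absK (emb t) = `|t|;
  mod_phase : forall x, exists2 u, absK u = 1 & u * x = emb (absK x);
  mod_ge0 : forall x, 0 <= absK x;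
  reD : forall x y, re (x + y) = re x + re y;
  imD : forall x y, im (x + y) = im x + im y;
  mod_sqr : forall x, absK x ^+ 2 = re x ^+ 2 + im x ^+ 2 }.

(** * Moments of sign sums with real or complex coefficients *)

Section Scalars.
Context {R : realType} {K : comNzRingType} {absK : K -> R}.
Context {emb : {rmorphism R -> K}} {re im : K -> R}.
Hypothesis HK : modulus absK emb re im.

Lemma mod0 : absK 0 = 0.
Proof. by rewrite -(rmorph0 emb) (mod_emb HK) normr0. Qed.

Lemma mod1 : absK 1 = 1.
Proof. by rewrite -(rmorph1 emb) (mod_emb HK) normr1. Qed.

Lemma modN x : absK (- x) = absK x.
Proof.
by rewrite -mulN1r (modM HK) -(rmorphN1 emb) (mod_emb HK) normrN1 mul1r.
Qed.

Lemma mod_sum (I : Type) (r : seq I) (P : pred I) (f : I -> K) :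
  absK (\sum_(i <- r | P i) f i) <= \sum_(i <- r | P i) absK (f i).
Proof.
elim/big_ind2 : _ => // [|x y z t xy zt]; first by rewrite mod0.
by apply: le_trans (mod_le HK _ _) _; apply: lerD.
Qed.

Lemma mod_prod (I : Type) (r : seq I) (P : pred I) (f : I -> K) :
  absK (\prod_(i <- r | P i) f i) = \prod_(i <- r | P i) absK (f i).
Proof. by elim/big_rec2 : _ => [|i x y _ <-]; rewrite ?mod1 ?(modM HK). Qed.

Lemma coordE (f : K -> R) : (forall x y, f (x + y) = f x + f y) ->
  f 0 = 0 /\ forall x, f (- x) = - f x.
Proof.
move=> fD; have f0 : f 0 = 0 by have := fD 0 0; rewrite addr0; lra.
by split=> // x; have := fD x (- x); rewrite subrr f0; lra.
Qed.

Let coord_sqr n (z : nat -> K) (f : K -> R) :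
  (forall x y, f (x + y) = f x + f y) ->
  radE n z (fun v => f v ^+ 2) = \sum_(j < n) f (z j) ^+ 2.
Proof.
move=> fD; have [f0 fN] := coordE fD.
rewrite (radE_comp _ _ (fun x => x ^+ 2) f0 fD fN).
have := radE_sqr n (fun j => f (z j)) 0; rewrite expr0n add0r => <-.
by apply: eq_radE => v; rewrite addr0.
Qed.

Let coord_fourth n (z : nat -> K) (f : K -> R) :
  (forall x y, f (x + y) = f x + f y) ->
  radE n z (fun v => f v ^+ 4) <= 3 * (\sum_(j < n) f (z j) ^+ 2) ^+ 2.
Proof.
move=> fD; have [f0 fN] := coordE fD.
rewrite (radE_comp _ _ (fun x => x ^+ 4) f0 fD fN).
have /= := radE_fourth n (fun j => f (z j)) 0.
rewrite !expr0n /= mulr0 mul0r !add0r; under eq_radE do rewrite addr0; exact.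
Qed.

Lemma radE_mod_sqr n (z : nat -> K) :
  radE n z (fun v => absK v ^+ 2) = \sum_(j < n) absK (z j) ^+ 2.
Proof.
under eq_radE do rewrite (mod_sqr HK).
rewrite radED (coord_sqr _ _ (reD HK)) (coord_sqr _ _ (imD HK)) -big_split /=.
by apply: eq_bigr => j _; rewrite (mod_sqr HK).
Qed.

(** The bound |v|^4 <= 2 (re v)^4 + 2 (im v)^4 reduces to the real coordinates, whose constant 3
    doubles to 6. *)
Lemma radE_mod_fourth n (z : nat -> K) :
  radE n z (fun v => absK v ^+ 4) <= 6 * (\sum_(j < n) absK (z j) ^+ 2) ^+ 2.
Proof.
have -> : \sum_(j < n) absK (z j) ^+ 2 =
    \sum_(j < n) re (z j) ^+ 2 + \sum_(j < n) im (z j) ^+ 2.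
  by rewrite -big_split; apply: eq_bigr => j _; rewrite (mod_sqr HK).
apply: (@le_trans _ _ (radE n z (fun v => 2 * re v ^+ 4 + 2 * im v ^+ 4))).
  apply: ler_radE => v.
  have e4 (x : R) : x ^+ 4 = (x ^+ 2) ^+ 2 by rewrite -exprM.
  rewrite !e4 (mod_sqr HK); have := sqr_ge0 (re v ^+ 2 - im v ^+ 2).
  by rewrite sqrrB sqrrD; set p := re v ^+ 2; set q := im v ^+ 2; lra.
rewrite radED !radEZ.
have := coord_fourth n z (reD HK); have := coord_fourth n z (imD HK).
set A := \sum_(j < n) re _ ^+ 2; set B := \sum_(j < n) im _ ^+ 2 => h1 h2.
have AB : 0 <= A * B.
  by rewrite mulr_ge0// sumr_ge0// => j _; rewrite sqr_ge0.
rewrite sqrrD; lra.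
Qed.

(** Averaging [powR_interp] bounds the second moment by an s-th moment and a fourth moment. The
    latter is controlled by the square of the second moment, so a suitable level [l] absorbs it. *)
Lemma khinchine n (z : nat -> K) (s : R) : 0 < s <= 2 ->
  (\sum_(j < n) absK (z j) ^+ 2) `^ (s / 2) <=
  24 * radE n z (fun v => absK v `^ s).
Proof.
move=> s02; have [s0 s2] := andP s02; set S := \sum_(j < n) _.
have E0 : 0 <= radE n z (fun v => absK v `^ s).
  by apply: radE_ge0 => v; apply: powR_ge0.
have : 0 <= S by apply: sumr_ge0 => j _; apply: sqr_ge0.
rewrite le_eqVlt => /predU1P[<-|S0].
  by rewrite powR0 ?mulr_ge0// gt_eqF// divr_gt0.
(* With [l ^+ 2 = 12 * S] the fourth-moment term is at most 6 S^2 / (12 S) = S / 2. Moving it to the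
   left costs a factor 2 and the constant in l^(2 - s) is at most 12, hence 24. *)
pose l := (12 * S) `^ 2^-1.
have S12 : 0 < 12 * S by rewrite mulr_gt0.
have l0 : 0 < l by apply: powR_gt0.
have l2 : l ^+ 2 = 12 * S.
  by rewrite -powR_mulrn ?ltW// powRVK ?pnatr_eq0// ltW.
have : radE n z (fun v => absK v ^+ 2) <=
    radE n z (fun v => l `^ (2 - s) * absK v `^ s + (l ^+ 2)^-1 * absK v ^+ 4).
  apply: ler_radE => v; rewrite [_^-1 * _]mulrC; apply: powR_interp => //.
  exact: mod_ge0 HK _.
rewrite radED !radEZ radE_mod_sqr -/S l2 => h.
have {}h : S <= l `^ (2 - s) * radE n z (fun v => absK v `^ s) + S / 2.
  apply: le_trans h _; rewrite lerD2l.
  rewrite mulrC ler_pdivrMr//; apply: le_trans (radE_mod_fourth _ _) _.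
  by rewrite -/S; lra.
have lE : l `^ (2 - s) <= 12 * S `^ (1 - s / 2).
  rewrite -powRrM mulrBr mulVf ?pnatr_eq0// [2^-1 * s]mulrC.
  rewrite powRM ?(ltW S0)// ler_wpM2r ?powR_ge0// -[leRHS]powRr1//.
  by rewrite ler_powR//; [rewrite ler1n|rewrite gerBl divr_ge0// (ltW s0)].
have Spos : 0 < S `^ (1 - s / 2) by apply: powR_gt0.
have SE : S = S `^ (s / 2) * S `^ (1 - s / 2).
  rewrite -powRD; last by rewrite (gt_eqF S0) implybT.
  by rewrite addrC subrK powRr1// ltW.
rewrite -(ler_pM2r Spos) -SE.
have := ler_wpM2r E0 lE; lra.
Qed.

(** Superadditivity of the power [s / 2] leads to the second moment, which is known exactly;
    Jensen's inequality then moves the power inside the average. *)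
Lemma radE_mod_powR n (z : nat -> K) (s : R) : 2 <= s ->
  \sum_(j < n) absK (z j) `^ s <= radE n z (fun v => absK v `^ s).
Proof.
move=> s2; have s12 : 1 <= s / 2 by lra.
have sE x : absK x `^ s = (absK x ^+ 2) `^ (s / 2).
  by rewrite -powR_mulrn ?(mod_ge0 HK)// -powRrM mulrC divfK ?pnatr_eq0.
under eq_bigr do rewrite sE.
apply: le_trans (sum_powR_superadd _ _ s12 (fun=> sqr_ge0 _)) _.
rewrite -radE_mod_sqr; under [leRHS]eq_radE do rewrite sE.
by apply: radE_powR => // v; apply: sqr_ge0.
Qed.
End Scalars.

(** * Truncated mixed norms and cotype *)

(* Only used for [f >= 0] and [p > 0]; the sum and the maximum range over
   [j < N]. *)
Definition fnorm (R : realType) (N : nat) (p : \bar R) (f : nat -> R) : R :=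
  if p is r%:E then (\sum_(j < N) f j `^ r) `^ r^-1
  else \big[Num.max/0]_(j < N) f j.

Fixpoint fmixed (R : realType) (N : nat) (r : seq (\bar R)) (a : seq nat -> R)
    : R :=
  if r is r1 :: r' then fnorm N r1 (fun j => fmixed N r' (fun s => a (j :: s)))
  else a [::].

Section FiniteNorms.
Context {R : realType}.
Implicit Types (N : nat) (p q : \bar R) (f g : nat -> R) (a b : seq nat -> R).

Lemma fnorm_ge0 N p f : 0 <= fnorm N p f.
Proof.
case: p => [r||] /=; first exact: powR_ge0.
  by elim/big_rec : _ => // j x _ x0; rewrite le_max x0 orbT.
by elim/big_rec : _ => // j x _ x0; rewrite le_max x0 orbT.
Qed.

Lemma eq_fnorm N p f g : (forall j, (j < N)%N -> f j = g j) ->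
  fnorm N p f = fnorm N p g.
Proof.
move=> fg; case: p => [r||] /=; [congr (_ `^ _)| |];
  by apply: eq_bigr => j _; rewrite fg.
Qed.

Lemma ler_fnorm N p f g : (0 < p)%E ->
  (forall j, (j < N)%N -> 0 <= f j <= g j) -> fnorm N p f <= fnorm N p g.
Proof.
have mx : (forall j, (j < N)%N -> 0 <= f j <= g j) ->
    \big[Num.max/0]_(j < N) f j <= \big[Num.max/0]_(j < N) g j.
  move=> fg; elim/big_ind2 : _ => // [x y z t xy zt|j _].
    by rewrite le_max2.
  by have /andP[] := fg j (ltn_ord j).
case: p => [r||] p0 fg /=; [|exact: mx..].
rewrite lte_fin in p0; apply: ler_powRl; first by rewrite invr_ge0 ltW.
  by apply: sumr_ge0 => j _; apply: powR_ge0.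
apply: ler_sum => j _; have /andP[f0 fgj] := fg j (ltn_ord j).
by apply: ler_powRl => //; apply: ltW.
Qed.

Lemma fnormZ N p f c : (0 < p)%E -> 0 <= c -> (forall j, 0 <= f j) ->
  fnorm N p (fun j => c * f j) = c * fnorm N p f.
Proof.
have mx : 0 <= c -> \big[Num.max/0]_(j < N) (c * f j) =
    c * \big[Num.max/0]_(j < N) f j.
  move=> c0; elim/big_rec2 : _ => [|j x y _ ->]; first by rewrite mulr0.
  by rewrite maxr_pMr.
case: p => [r||] p0 c0 f0 /=; [|exact: mx..].
rewrite lte_fin in p0.
under eq_bigr do rewrite powRM//.
rewrite -mulr_sumr powRM ?powR_ge0//; last first.
  by apply: sumr_ge0 => j _; apply: powR_ge0.
by rewrite powRK ?gt_eqF.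
Qed.

Lemma le_fnorm_coord N p f j : (0 < p)%E -> (forall i, 0 <= f i) -> (j < N)%N ->
  f j <= fnorm N p f.
Proof.
move=> + f0 jN; have mx : f j <= \big[Num.max/0]_(i < N) f i.
  by rewrite (bigD1 (Ordinal jN)) //= le_max lexx.
case: p => [r||] p0 /=; [|exact: mx..].
rewrite lte_fin in p0.
rewrite -[leLHS](@powRK R r) ?gt_eqF// ler_powRl ?powR_ge0//.
  by rewrite invr_ge0 ltW.
rewrite (bigD1 (Ordinal jN)) //= lerDl.
by apply: sumr_ge0 => i _; apply: powR_ge0.
Qed.

Lemma fnorm_oo_le N f D : 0 <= D -> (forall j, (j < N)%N -> f j <= D) ->
  fnorm N +oo%E f <= D.
Proof.
move=> D0 fD /=; elim/big_ind : _ => [//|x y xD yD|j _]; last exact: fD.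
by rewrite ge_max xD.
Qed.

Lemma fnorm_anti N p q f : (0 < p)%E -> (p <= q)%E -> (forall j, 0 <= f j) ->
  fnorm N q f <= fnorm N p f.
Proof.
move=> p0 pq f0; case: q pq => [q||] pq.
- case: p p0 pq => [p||] + + /=; rewrite ?lte_fin ?lee_fin ?leye_eq => p0 pq;
    [|by []..].
  exact: powR_sum_le.
- apply: fnorm_oo_le; first exact: fnorm_ge0.
  by move=> j jN; apply: le_fnorm_coord.
- by have := lt_le_trans p0 pq.
Qed.

Lemma fnorm_powR N r f : r != 0 ->
  fnorm N r%:E f `^ r = \sum_(j < N) f j `^ r.
Proof.
move=> r0 /=; rewrite powRVK//.
by apply: sumr_ge0 => j _; apply: powR_ge0.
Qed.

Definition pos_exps (r : seq (\bar R)) := all (fun p => 0 < p)%E r.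

Lemma fmixed_ge0 N r a : (forall s, 0 <= a s) -> 0 <= fmixed N r a.
Proof. by case: r => //= p r a0; exact: fnorm_ge0. Qed.

Lemma eq_fmixed N r a b : a =1 b -> fmixed N r a = fmixed N r b.
Proof. by move=> /funext ->. Qed.

Lemma eq_fmixed_lt N r a b :
  (forall s, size s = size r -> all (fun j => j < N)%N s -> a s = b s) ->
  fmixed N r a = fmixed N r b.
Proof.
elim: r a b => [|p r IH] a b ab /=; first exact: ab.
apply: eq_fnorm => j jN; apply: IH => s sr sN.
by apply: ab; rewrite /= ?sr ?jN.
Qed.

Lemma fmixedZ N r a c : pos_exps r -> 0 <= c -> (forall s, 0 <= a s) ->
  fmixed N r (fun s => c * a s) = c * fmixed N r a.
Proof.
elim: r a => [//|p r IH] a /= /andP[p0 r0] c0 a0.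
rewrite -fnormZ//; last by move=> j; apply: fmixed_ge0.
by apply: eq_fnorm => j _; rewrite IH.
Qed.

(** This reduces sufficiency to the smallest admissible exponents. *)
Lemma fmixed_anti N (r q : seq (\bar R)) a : size r = size q -> pos_exps r ->
  (forall i, (nth 0 r i <= nth 0 q i)%E) -> (forall s, 0 <= a s) ->
  fmixed N q a <= fmixed N r a.
Proof.
elim: r q a => [|p r IH] [|p' q] a //= [rq] /andP[p0 r0] le a0.
have pp' := le 0%N; apply: le_trans (fnorm_anti N p0 pp' _) _ => [j|].
  exact: fmixed_ge0.
apply: ler_fnorm => // j _; rewrite fmixed_ge0 ?IH// => i.
exact: (le i.+1).
Qed.

End FiniteNorms.

Section Cotype.
Context {R : realType} {K : comNzRingType} {absK : K -> R}.
Context {emb : {rmorphism R -> K}} {re im : K -> R}.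
Hypothesis HK : modulus absK emb re im.

Local Notation vmixed N r v := (fmixed N r (fun s : seq nat => absK (v s))).

(* Rademacher cotype [c] of the mixed-norm space with exponents [r], uniformly
   in the truncation [N]. *)
Definition cotype (c : R) (r : seq (\bar R)) := exists2 C : R, 0 <= C &
  forall N n (y : nat -> seq nat -> K),
    \sum_(j < n) vmixed N r (y j) `^ c <=
    C * radE n y (fun v => vmixed N r v `^ c).

Lemma radE_eval n (y : nat -> seq nat -> K) s (G : K -> R) :
  radE n y (fun v => G (v s)) = radE n (fun j => y j s) G.
Proof. by apply: (@radE_comp R _ _ n y (fun v => v s)). Qed.

Lemma radE_head n (y : nat -> seq nat -> K) k (G : (seq nat -> K) -> R) :
  radE n y (fun v => G (fun s => v (k :: s))) =
  radE n (fun j s => y j (k :: s)) G.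
Proof. by apply: (@radE_comp R _ _ n y (fun v s => v (k :: s))). Qed.

(** For each value of the outer index, write q-th powers as powers [q / c >= 1] of c-th powers.
    Superadditivity pulls this power out of the sum, cotype [c] applies, and Jensen's inequality
    moves the power inside the average. *)
Lemma cotype_cons c q r : 0 < c -> c <= q ->
  cotype c r -> cotype q (q%:E :: r).
Proof.
move=> c0 cq [C C0 HC]; have q0 : 0 < q by lra.
have qc : 1 <= q / c by rewrite ler_pdivlMr ?mul1r.
exists (C `^ (q / c)); first exact: powR_ge0.
move=> N n y.
have normE v : vmixed N (q%:E :: r) v `^ q =
    \sum_(k < N) vmixed N r (fun s => v (val k :: s)) `^ q.
  by rewrite fnorm_powR ?gt_eqF.
under eq_bigr do rewrite normE.
under eq_radE do rewrite normE.
rewrite radE_sum mulr_sumr exchange_big /=; apply: ler_sum => k _.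
rewrite (radE_head n y k (fun v => vmixed N r v `^ q)).
set z := fun j s => y j (val k :: s).
have qE (x : R) : x `^ q = (x `^ c) `^ (q / c).
  by rewrite -powRrM mulrCA divff ?gt_eqF// mulr1.
under eq_bigr do rewrite qE.
under eq_radE do rewrite qE.
apply: le_trans (sum_powR_superadd _ _ qc (fun=> powR_ge0 _ _)) _.
apply: (@le_trans _ _ ((C * radE n z (fun v => vmixed N r v `^ c)) `^ (q / c))).
  apply: ler_powRl; [lra| |exact: HC].
  by apply: sumr_ge0 => j _; apply: powR_ge0.
rewrite powRM//; last by apply: radE_ge0 => v; apply: powR_ge0.
rewrite ler_wpM2l ?powR_ge0//; apply: radE_powR => // v; exact: powR_ge0.
Qed.

Lemma cotype_lge2 (s : R) : 2 <= s -> cotype s [:: s%:E].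
Proof.
move=> s2; have s0 : s != 0 by rewrite gt_eqF//; lra.
exists 1 => // N n y; rewrite mul1r.
under eq_bigr do rewrite fnorm_powR//.
under [leRHS]eq_radE do rewrite fnorm_powR//.
rewrite radE_sum exchange_big /=; apply: ler_sum => k _.
rewrite (radE_eval n y [:: val k] (fun x => absK x `^ s)).
exact: (radE_mod_powR HK).
Qed.

(** Minkowski's inequality with exponent [2 / s] exchanges the sums over vectors and coordinates,
    Khinchine's inequality acts in each coordinate, and Jensen's inequality moves the power [2 / s]
    inside the average. *)
Lemma cotype_lle2 (s : R) : 1 <= s <= 2 -> cotype 2 [:: s%:E].
Proof.
move=> /andP[s1 s2]; have s0 : 0 < s by lra.
have sN : s != 0 by rewrite gt_eqF.
have s21 : 1 <= 2 / s by rewrite ler_pdivlMr// mul1r.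
have s20 : 0 < 2 / s by lra.
exists (24 `^ (2 / s)); first exact: powR_ge0.
move=> N n y; set S := fun v : seq nat -> K => \sum_(k < N) absK (v [:: val k]) `^ s.
have S0 v : 0 <= S v by apply: sumr_ge0 => k _; apply: powR_ge0.
have normE v : vmixed N [:: s%:E] v `^ 2 = S v `^ (2 / s).
  by rewrite /= -powRrM mulrC.
under eq_bigr do rewrite normE.
under [in leRHS]eq_radE do rewrite normE.
have m := @minkowski_sum R _ _ (index_enum 'I_N) (index_enum 'I_n) _
  (fun k j => absK (y (val j) [:: val k]) `^ s) s21 (fun _ _ => powR_ge0 _ _).
rewrite -[leLHS](@powRVK R (2 / s)) ?gt_eqF//; last first.
  by apply: sumr_ge0 => j _; apply: powR_ge0.
apply: (@le_trans _ _ ((24 * radE n y S) `^ (2 / s))); last first.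
  rewrite powRM ?radE_ge0// ler_wpM2l ?powR_ge0//.
  exact: radE_powR.
apply: ler_powRl; [exact: ltW|exact: powR_ge0|].
apply: le_trans m _; rewrite radE_sum mulr_sumr; apply: ler_sum => k _.
rewrite (radE_eval n y [:: val k] (fun x => absK x `^ s)).
apply: le_trans (khinchine HK n (fun j => y j [:: val k]) (_ : 0 < s <= 2)).
  rewrite invf_div le_eqVlt; apply/orP; left; apply/eqP; congr (_ `^ _).
  apply: eq_bigr => j _; rewrite -powRrM mulrCA divff// mulr1 powR_mulrn//.
  exact: mod_ge0 HK _.
by rewrite s0.
Qed.
End Cotype.

Arguments cotype {R K} absK c r.

(** * Exponents through their reciprocals, and duality *)

Definition invx (R : realType) (p : \bar R) : R := fine p^-1%E.

(** The conditions are linear in reciprocals of exponents. A nonpositive reciprocal stands for the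
    exponent [+oo], in agreement with the maximum with 0 in [delta]. *)
Definition inv_exp (R : realType) (v : R) : \bar R :=
  if 0 < v then v^-1%:E else +oo%E.

Section Exponents.
Context {R : realType}.
Implicit Types (p q : \bar R) (v w : R).

Lemma ge1_ereal p : (1 <= p)%E -> (exists2 r : R, 1 <= r & p = r%:E) \/ p = +oo%E.
Proof.
case: p => [r| |]; rewrite ?lee_fin ?leeNy_eq => p1; [by left; exists r|by right|].
by [].
Qed.

Lemma invx_EFin (r : R) : invx r%:E = r^-1.
Proof.
rewrite /invx inver; case: eqP => [->|//]; by rewrite invr0.
Qed.

Lemma invx_oo : invx (+oo%E : \bar R) = 0.
Proof. by rewrite /invx invey. Qed.

Lemma invx_itv p : (1 <= p)%E -> 0 <= invx p <= 1.
Proof.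
case/ge1_ereal => [[r r1 ->]|->]; last by rewrite invx_oo lexx ler01.
rewrite invx_EFin invr_ge0 invf_le1 ?r1 ?andbT; lra.
Qed.

Lemma invx_le1 p : (1 <= p)%E -> invx p <= 1.
Proof. by move=> /invx_itv/andP[]. Qed.

Lemma invx_ge0 p : (1 <= p)%E -> 0 <= invx p.
Proof. by move=> /invx_itv/andP[]. Qed.

Lemma inve_invx p : (1 <= p)%E -> (p^-1)%E = (invx p)%:E.
Proof.
case/ge1_ereal => [[r r1 ->]|->]; last by rewrite invx_oo invey.
rewrite invx_EFin inver gt_eqF//; lra.
Qed.

Lemma inv_exp_gt0 v : (0 < inv_exp v)%E.
Proof. by rewrite /inv_exp; case: ifP => // v0; rewrite lte_fin invr_gt0. Qed.

Lemma hoelder_conjugateE p : (1 <= p)%E ->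
  hoelder_conjugate p = inv_exp (1 - invx p).
Proof.
rewrite /hoelder_conjugate /inv_exp; case/ge1_ereal => [[r r1 ->]|->]; last first.
  by rewrite invx_oo subr0 ltr01 invr1.
rewrite invx_EFin /=; have r0 : 0 < r by lra.
rewrite gt_eqF ?lte_fin// subr_gt0 invf_lt1// inver subr_eq0.
have [->|rN1] := eqVneq r 1; first by rewrite ltxx mul1e.
have r1' : 1 < r by rewrite lt_neqAle eq_sym rN1.
rewrite r1' -EFinM; congr (_%:E); field.
by rewrite subr_eq0 rN1 gt_eqF.
Qed.

(** For infinite [p] the power [u] is 0, and every entry is 1, including 0^0. *)
Lemma fnorm_pow_le1 N p (u : R) (w : nat -> R) : (1 <= p)%E -> invx p = u ->
  (forall j, 0 <= w j) -> \sum_(j < N) w j <= 1 ->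
  fnorm N p (fun j => w j `^ u) <= 1.
Proof.
move=> /ge1_ereal[[r p1 ->]|->] pu w0 w1.
  have r0 : 0 < r by lra.
  rewrite -pu invx_EFin /=; under eq_bigr do rewrite powRVK ?gt_eqF//.
  apply: (@le_trans _ _ (1 `^ r^-1)); last by rewrite powR1.
  rewrite ler_powRl ?invr_ge0 ?(ltW r0)//.
  exact: sumr_ge0.
rewrite -pu invx_oo; apply: fnorm_oo_le => // j _.
by rewrite powRr0.
Qed.

(** A converse of Hölder's inequality for 1/c = 1/p + 1/r: a multiplier from l_p to l_c lies in l_r.
    The case [c = 1] is the usual duality. *)
Lemma fnorm_dual N p (c r D : R) (t : nat -> R) : (1 <= p)%E -> 0 < c -> 0 < r ->
  r^-1 = c^-1 - invx p -> 0 <= D -> (forall j, 0 <= t j) ->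
  (forall a : nat -> R, (forall j, 0 <= a j) -> fnorm N p a <= 1 ->
    \sum_(j < N) (a j * t j) `^ c <= D `^ c) ->
  fnorm N r%:E t <= D.
Proof.
move=> p1 c0 r0; set u := invx p => rE D0 t0 h /=.
set T := \sum_(j < N) t j `^ r.
have : 0 <= T by apply: sumr_ge0 => j _; apply: powR_ge0.
rewrite le_eqVlt => /predU1P[<-|T0].
  by rewrite powR0// invr_neq0// gt_eqF.
have TV : 0 <= T^-1 by rewrite invr_ge0 ltW.
(* the weights for which Hölder's inequality is an equality *)
have := h (fun j => (t j `^ r / T) `^ u).
have aE j : ((t j `^ r / T) `^ u * t j) `^ c = t j `^ r * T^-1 `^ (u * c).
  rewrite powRM ?powR_ge0// -powRrM powRM ?powR_ge0// mulrAC -powRrM.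
  have cE : r * (u * c) + c = r.
    have /eqP : r^-1 = c^-1 - u by [].
    have -> : u = c^-1 - r^-1 by rewrite rE; lra.
    by move=> _; field; rewrite !gt_eqF.
  by rewrite -powRD cE// gt_eqF.
under eq_bigr do rewrite aE.
rewrite -mulr_suml -/T => {}h.
have {h} := h (fun j => powR_ge0 _ _).
have w1 : fnorm N p (fun j => (t j `^ r / T) `^ u) <= 1.
  apply: fnorm_pow_le1 => // [j|]; first by rewrite mulr_ge0 ?powR_ge0.
  by rewrite -mulr_suml divff// gt_eqF.
move=> /(_ w1).
(* The exponents agree because 1 - u c = c (1/c - u) = c / r. *)
have -> : T * T^-1 `^ (u * c) = (T `^ r^-1) `^ c.
  rewrite -powR_inv1 ?(ltW T0)// -powRrM -{1}(powRr1 (ltW T0)) -powRD.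
    rewrite -powRrM rE; congr (_ `^ _); field; rewrite gt_eqF//.
  by rewrite (gt_eqF T0) implybT.
by rewrite ler_powRlP ?powR_ge0.
Qed.
End Exponents.

Arguments fnorm : simpl never.

(* [gap ps pm] is [1 - (1/p_1 + ... + 1/p_(m-1) + 1/mu)], where
   [mu = min(pm, 2)]. *)
Definition gap (R : realType) (ps : seq (\bar R)) (pm : \bar R) : R :=
  Num.min (1 - invx pm) 2^-1 - \sum_(p <- ps) invx p.

(* The smallest exponents allowed by the condition, followed by the conjugate
   of [pm]. *)
Fixpoint exps (R : realType) (ps : seq (\bar R)) (pm : \bar R) : seq (\bar R) :=
  if ps is p :: ps' then inv_exp (gap ps pm) :: exps ps' pm
  else [:: inv_exp (1 - invx pm)].

(** * The inequality on finite truncations *)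

Section FiniteInequality.
Context {R : realType} {K : comNzRingType} {absK : K -> R}.
Context {emb : {rmorphism R -> K}} {re im : K -> R}.
Hypothesis HK : modulus absK emb re im.
Implicit Types (p pm : \bar R) (ps : seq (\bar R)).

Lemma gap_cons p ps pm : gap (p :: ps) pm = gap ps pm - invx p.
Proof. by rewrite /gap big_cons; lra. Qed.

Lemma pos_exps_exps ps pm : pos_exps (exps ps pm).
Proof. by elim: ps => [|p ps IH] /=; rewrite inv_exp_gt0. Qed.

Lemma size_exps ps pm : size (exps ps pm) = (size ps).+1.
Proof. by elim: ps => [|p ps IH] //=; rewrite IH. Qed.

(** For empty [ps] the cotype is the maximum of 2 and the conjugate of [pm], whence the split at 2.
    Each further variable lowers the gap, so its inverse grows and [cotype_cons] applies. *)
Lemma cotype_exps ps pm : all (fun p => 1 <= p)%E ps -> (1 <= pm)%E ->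
  0 < gap ps pm -> cotype absK (gap ps pm)^-1 (exps ps pm).
Proof.
move=> + pm1; elim: ps => [_|p ps IH /=].
  rewrite /gap big_nil subr0 /= /inv_exp.
  have u0 := invx_ge0 pm1; set v := 1 - invx pm => m0.
  have v0 : 0 < v by move: m0; rewrite lt_min => /andP[].
  have v1 : v <= 1 by rewrite /v; lra.
  rewrite v0; have [vh|hv] := leP v 2^-1.
    by apply: (cotype_lge2 HK); rewrite -[leLHS]invrK lef_pV2 ?posrE ?invr_gt0.
  rewrite invrK; apply: (cotype_lle2 HK); rewrite invf_ge1 ?v1//=.
  by rewrite -[leRHS]invrK lef_pV2 ?posrE ?invr_gt0// ltW.
move=> /andP[p1 ps1]; rewrite /inv_exp => g0; rewrite g0.
have u0 := invx_ge0 p1; have g0' : 0 < gap ps pm by move: g0; rewrite gap_cons; lra.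
apply: (@cotype_cons _ _ _ (gap ps pm)^-1); [by rewrite invr_gt0| |exact: IH].
by rewrite lef_pV2 ?posrE// gap_cons; lra.
Qed.

Section Linear.
Variable F : (nat -> K) -> K.
Hypothesis Flin : forall a u v, F (fun j => a * u j + v j) = a * F u + F v.

Lemma lin0 : F (fun=> 0) = 0.
Proof.
have := Flin 1 (fun=> 0) (fun=> 0).
rewrite (_ : (fun j => _) = fun=> 0); last by apply/funext => j; rewrite mulr0 addr0.
by rewrite mul1r => /eqP; rewrite -subr_eq0 opprD addrA subrr sub0r oppr_eq0 => /eqP.
Qed.

Lemma lin_sum N (c : nat -> K) :
  F (fun k => if (k < N)%N then c k else 0) =
  \sum_(j < N) c j * F (unit_vec K j).
Proof.
elim: N => [|N IH]; first by rewrite big_ord0 lin0.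
rewrite big_ord_recr /= -IH addrC -Flin; congr F; apply/funext => k.
rewrite /unit_vec ltnS leq_eqVlt; case: eqP => [->|_] /=.
  by rewrite ltnn mulr1 addr0.
by rewrite mulr0 add0r.
Qed.
End Linear.

Lemma fnorm_unit N p j : (1 <= p)%E -> (j < N)%N ->
  fnorm N p (fun k => absK (unit_vec K j k)) <= 1.
Proof.
move=> p1 jN; have uE k : absK (unit_vec K j k) = (k == j)%:R.
  by rewrite /unit_vec; case: eqP; rewrite ?(mod1 HK) ?(mod0 HK).
case/ge1_ereal: p1 => [[r r1 ->]|->]; last first.
  by apply: fnorm_oo_le => // k _; rewrite uE; case: eqP.
rewrite /fnorm (bigD1 (Ordinal jN))//= big1 ?uE ?eqxx ?addr0 ?powR1//.
move=> k; rewrite -val_eqE /= => /negbTE kj; rewrite uE kj powR0// gt_eqF//; lra.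
Qed.

Definition in_balls N ps (l : seq (nat -> K)) :=
  all2 (fun p v => fnorm N p (fun j => absK (v j)) <= 1) ps l.

(** The constant is chosen before [N], which later permits the passage to infinite arrays. Forms act
    on lists of vectors so that fixing the first argument gives a form to which the induction
    hypothesis applies. *)
Lemma finite_inequality ps pm : all (fun p => 1 <= p)%E ps -> (1 <= pm)%E ->
  exists2 C : R, 0 <= C & forall N (B : seq (nat -> K) -> K) M, 0 <= M ->
  (forall l1 l2 a u v, (size l1 + size l2)%N = size ps ->
    B (l1 ++ (fun j => a * u j + v j) :: l2) =
    a * B (l1 ++ u :: l2) + B (l1 ++ v :: l2)) ->
  (forall l, in_balls N (rcons ps pm) l -> absK (B l) <= M) ->
  fmixed N (exps ps pm) (fun s => absK (B (map (unit_vec K) s))) <= C * M.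
Proof.
move=> + pm1; elim: ps => [_|p ps IH /=].
  exists 1 => // N B M M0 Blin BM; rewrite mul1r.
  have u1 := invx_le1 pm1; have {}Blin a u v := Blin [::] [::] a u v erefl.
  have bM (x : nat -> K) : fnorm N pm (fun j => absK (x j)) <= 1 -> absK (B [:: x]) <= M.
    by move=> xM; apply: BM; rewrite /in_balls /= xM.
  rewrite [exps _ _]/= /inv_exp; case: ifPn => [v0|_] /=; last first.
    by apply: fnorm_oo_le => // j jN; apply: bM; apply: fnorm_unit.
  pose t j := absK (B [:: unit_vec K j]).
  have t0 j : 0 <= t j by exact: mod_ge0 HK _.
  apply: (@fnorm_dual _ N pm 1 _ _ t) => //; rewrite ?invr_gt0 ?invr1 ?invrK//.
  move=> a a0 an.
  (* These phases of modulus 1 make the coefficients nonnegative, so that the sum of the [a j * t j]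
     is the modulus of a single value of [B]. *)
  pose ph j := sval (cid2 (mod_phase HK (B [:: unit_vec K j]))).
  have [phM phE] : (forall j, absK (ph j) = 1) /\
      (forall j, ph j * B [:: unit_vec K j] = emb (t j)).
    by split=> j; rewrite /ph; case: cid2.
  pose x k := if (k < N)%N then emb (a k) * ph k else 0.
  have xn : fnorm N pm (fun k => absK (x k)) <= 1.
    apply: le_trans an; rewrite le_eqVlt; apply/orP; left; apply/eqP.
    apply: eq_fnorm => k kN; rewrite /x kN (modM HK) (mod_emb HK) phM mulr1.
    by rewrite ger0_norm.
  have := bM x xn; rewrite (lin_sum (F := fun v => B [:: v]) Blin).
  under eq_bigr do rewrite -mulrA phE -rmorphM.
  rewrite -rmorph_sum (mod_emb HK) ger0_norm; last first.
    by apply: sumr_ge0 => j _; rewrite mulr_ge0.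
  rewrite powRr1//; apply: le_trans; rewrite le_eqVlt; apply/orP; left; apply/eqP.
  by apply: eq_bigr => j _; rewrite powRr1// mulr_ge0.
move=> /andP[p1 ps1]; have [C C0 HC] := IH ps1.
pose vm N x (B : seq (nat -> K) -> K) :=
  fmixed N (exps ps pm) (fun s => absK (B (x :: map (unit_vec K) s))).
(* The induction hypothesis with the first argument frozen at a vector [x] of the unit ball. *)
have step N (B : seq (nat -> K) -> K) M x : 0 <= M ->
  (forall l1 l2 a u v, (size l1 + size l2)%N = (size ps).+1 ->
    B (l1 ++ (fun j => a * u j + v j) :: l2) =
    a * B (l1 ++ u :: l2) + B (l1 ++ v :: l2)) ->
  (forall l, in_balls N (p :: rcons ps pm) l -> absK (B l) <= M) ->
  fnorm N p (fun j => absK (x j)) <= 1 -> vm N x B <= C * M.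
  move=> M0 Blin BM xn; apply: (HC N (fun l => B (x :: l))) => //.
    move=> l1 l2 a u v s12; apply: (Blin (x :: l1)); by rewrite /= addSn s12.
  by move=> l ls; apply: BM; rewrite /in_balls /= xn.
(* Without a positive gap the outer norm is a supremum, and [step] at the unit vectors suffices. *)
have [g0|g0] := boolP (0 < gap (p :: ps) pm); last first.
  exists C => // N B M M0 Blin BM; rewrite /inv_exp (negbTE g0).
  apply: fnorm_oo_le; first by rewrite mulr_ge0.
  by move=> j jN; apply: (step _ _ _ (unit_vec K j)) => //; apply: fnorm_unit.
have u0 := invx_ge0 p1.
have g0' : 0 < gap ps pm by move: g0; rewrite gap_cons; lra.
have [D D0 HD] := cotype_exps ps1 pm1 g0'.
set c := (gap ps pm)^-1 in HD; have c0 : 0 < c by rewrite invr_gt0.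
exists (D `^ c^-1 * C); first by rewrite mulr_ge0 ?powR_ge0.
move=> N B M M0 Blin BM; rewrite /inv_exp g0.
pose t j := vm N (unit_vec K j) B.
have t0 j : 0 <= t j by apply: fmixed_ge0 => s; exact: mod_ge0 HK _.
have CM0 : 0 <= C * M by rewrite mulr_ge0.
apply: (@fnorm_dual _ N p c _ _ t) => //.
- by rewrite invr_gt0.
- by rewrite invrK /c invrK gap_cons.
- by rewrite mulr_ge0// mulr_ge0 ?powR_ge0.
move=> a a0 an.
pose y j (s : seq nat) := emb (a j) * B (unit_vec K j :: map (unit_vec K) s).
have -> : \sum_(j < N) (a j * t j) `^ c =
    \sum_(j < N) fmixed N (exps ps pm) (fun s => absK (y j s)) `^ c.
  apply: eq_bigr => j _; congr (_ `^ _).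
  rewrite /t /vm -fmixedZ ?pos_exps_exps//; last by move=> s; exact: mod_ge0 HK _.
  by apply: eq_fmixed => s; rewrite /y (modM HK) (mod_emb HK) ger0_norm.
apply: le_trans (HD N N y) _.
rewrite -mulrA powRM ?powR_ge0// powRVK ?gt_eqF// ler_wpM2l//.
apply: radE_le => e.
apply: ler_powRl (ltW c0) _ _; first by apply: fmixed_ge0 => s; exact: mod_ge0 HK _.
(* By linearity a signed sum of the arrays [y j] is the array of [B] at this one vector, whose norm
   does not depend on the signs. *)
pose x k := if (k < N)%N then (-1) ^+ e k * emb (a k) else 0.
have xn : fnorm N p (fun k => absK (x k)) <= 1.
  apply: le_trans an; rewrite le_eqVlt; apply/orP; left; apply/eqP.
  apply: eq_fnorm => k kN; rewrite /x kN mulr_sign fun_if (modN HK) if_same.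
  by rewrite (mod_emb HK) ger0_norm.
apply: le_trans (step N B M x M0 Blin BM xn).
rewrite le_eqVlt; apply/orP; left; apply/eqP.
apply: eq_fmixed_lt => s; rewrite size_exps => -[sz] _; congr absK.
rewrite /= (lin_sum (F := fun v => B (v :: map (unit_vec K) s))) => [|a' u v].
  rewrite fct_sumE; apply: eq_bigr => j _; rewrite mulr_sign.
  by case: (e j); rewrite /y ?mulNr.
by apply: (Blin [::]); rewrite size_map add0n sz.
Qed.
End FiniteInequality.

(** * Norms of infinite sequences *)

Section SequenceNorms.
Context {R : realType}.
Implicit Types (p : \bar R) (f g : nat -> \bar R).

Lemma gt0_ereal p : (0 < p)%E -> (exists2 r : R, 0 < r & p = r%:E) \/ p = +oo%E.
Proof.
case: p => [r| |]; rewrite ?lte_fin => p0; [by left; exists r|by right|].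
by [].
Qed.

Lemma poweRK (r : R) (x : \bar R) : 0 < r -> (0 <= x)%E ->
  poweR (poweR x r) r^-1 = x.
Proof. by move=> r0 x0; rewrite -poweRrM divff ?gt_eqF// poweRe1. Qed.

Lemma poweRVK (r : R) (x : \bar R) : 0 < r -> (0 <= x)%E ->
  poweR (poweR x r^-1) r = x.
Proof. by move=> r0 x0; rewrite -poweRrM mulVf ?gt_eqF// poweRe1. Qed.

Lemma ler_poweR (r : R) (x y : \bar R) : 0 <= r -> (0 <= x)%E -> (x <= y)%E ->
  (poweR x r <= poweR y r)%E.
Proof.
move=> r0 x0 xy; apply: gt0_ler_poweR => //; rewrite in_itv /= leey andbT//.
exact: le_trans xy.
Qed.

Lemma poweR_sup (r : R) (u : nat -> \bar R) : 0 < r -> (forall n, 0 <= u n)%E ->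
  poweR (ereal_sup (range u)) r = ereal_sup (range (fun n => poweR (u n) r)).
Proof.
move=> r0 u0; have s0 : (0 <= ereal_sup (range u))%E.
  by apply: le_trans (u0 0%N) _; apply: ereal_sup_ubound; exists 0%N.
apply/eqP; rewrite eq_le; apply/andP; split; last first.
  apply: ge_ereal_sup => _ [n _ <-]; apply: ler_poweR => //; first exact: ltW.
  by apply: ereal_sup_ubound; exists n.
set S := ereal_sup _; set T := ereal_sup _.
have T0 : (0 <= T)%E.
  by apply: le_trans (poweR_ge0 (u 0%N) r) _; apply: ereal_sup_ubound; exists 0%N.
suff ST : (S <= poweR T r^-1)%E.
  by rewrite -[leRHS](poweRVK r0 T0); apply: ler_poweR => //; exact: ltW.
apply: ge_ereal_sup => _ [n _ <-].
rewrite -[leLHS](poweRK r0 (u0 n)).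
apply: ler_poweR; rewrite ?poweR_ge0 ?invr_ge0 ?(ltW r0)//.
by apply: ereal_sup_ubound; exists n.
Qed.

Lemma lnorm_EFin (r : R) f : 0 < r -> (forall j, 0 <= f j)%E ->
  lnorm r%:E f = poweR (\sum_(0 <= k <oo) poweR (f k) r)%E r^-1.
Proof.
move=> r0 f0; rewrite /lnorm Lnorm_counting//; congr poweR.
by apply: eq_eseriesr => k _; rewrite gee0_abs.
Qed.

(** The only null set of the counting measure is empty, so the essential supremum is a supremum. *)
Lemma lnorm_oo_le f (B : \bar R) : (forall j, 0 <= f j)%E ->
  (lnorm +oo%E f <= B)%E <-> forall j, (f j <= B)%E.
Proof.
move=> f0; rewrite /lnorm unlock.
have c0 (A : set nat) : @counting nat R A = 0%E -> A = set0.
  rewrite /counting; case: ifPn => // /asboolP fA [/eqP].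
  rewrite pnatr_eq0 finmap.cardfs_eq0 => /eqP fA0.
  by rewrite -(fset_setK fA) fA0 set_fset0.
have -> : (0 < @counting nat R [set: nat])%E.
  rewrite lt0e measure_ge0 andbT; apply/eqP => /c0 /seteqP[h _].
  exact: (h 0%N I).
split=> [/ess_supP[A [mA /c0 -> sA]] j|fB].
  by apply: contrapT => fjB; have := sA j; rewrite /= gee0_abs//; apply.
apply/ess_supP; apply: nearW => j /=; by rewrite gee0_abs.
Qed.

Lemma lnorm_ge0 p f : (0 <= lnorm p f)%E.
Proof. exact: Lnorm_ge0. Qed.

Lemma ler_lnorm p f g : (0 < p)%E -> (forall j, 0 <= f j <= g j)%E ->
  (lnorm p f <= lnorm p g)%E.
Proof.
move=> /gt0_ereal[[r r0 ->]|->] fg; have f0 j : (0 <= f j)%E by have /andP[] := fg j.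
  have g0 j : (0 <= g j)%E by have /andP[/le_trans h /h] := fg j.
  rewrite !lnorm_EFin//; apply: ler_poweR.
  - by rewrite invr_ge0 ltW.
  - by apply: nneseries_ge0 => *; apply: poweR_ge0.
  apply: lee_nneseries => [*|j _]; first exact: poweR_ge0.
  have /andP[_ fgj] := fg j.
  by apply: ler_poweR => //; exact: ltW.
have g0 j : (0 <= g j)%E by have /andP[/le_trans h /h] := fg j.
apply/lnorm_oo_le => // j; have /andP[_ /le_trans] := fg j; apply.
by move: j; apply/lnorm_oo_le.
Qed.

Lemma lnorm_trunc N p (f : nat -> R) : (0 < p)%E -> (forall j, 0 <= f j) ->
  lnorm p (fun j => if (j < N)%N then (f j)%:E else 0%E) = (fnorm N p f)%:E.
Proof.
move=> /gt0_ereal[[r r0 ->]|->] f0.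
  rewrite lnorm_EFin//; last by move=> j; case: ifP; rewrite ?lee_fin.
  rewrite (@nneseries_split _ _ 0%N N); last by move=> *; apply: poweR_ge0.
  rewrite eseries0 ?adde0; last first.
    by move=> j; rewrite add0n leqNgt => /negbTE -> _; rewrite poweR0r// gt_eqF.
  rewrite add0n big_mkord /fnorm -poweR_EFin -sumEFin; congr poweR.
  by apply: eq_bigr => j _; rewrite ltn_ord poweR_EFin.
have t0 j : (0 <= if (j < N)%N then (f j)%:E else 0)%E.
  by case: ifP; rewrite ?lee_fin.
apply/eqP; rewrite eq_le; apply/andP; split.
  apply/lnorm_oo_le => // j; case: ifP => jN; last by rewrite lee_fin fnorm_ge0.
  by rewrite lee_fin le_fnorm_coord.
have := lnorm_oo_le (lnorm +oo%E (fun j => if (j < N)%N then (f j)%:E else 0%E)) t0.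
move=> [/(_ (lexx _)) + _]; move: (lnorm_ge0 +oo%E
  (fun j => if (j < N)%N then (f j)%:E else 0%E)); case: (lnorm _ _) => [x||].
- rewrite !lee_fin => x0 fx; apply: fnorm_oo_le => // j jN.
  by have := fx j; rewrite jN lee_fin.
- by move=> _ _; rewrite leey.
- by [].
Qed.

Lemma fnorm_le_lnorm N p (f : nat -> R) g : (0 < p)%E -> (forall j, 0 <= f j) ->
  (forall j, 0 <= g j)%E -> (forall j, (j < N)%N -> ((f j)%:E <= g j)%E) ->
  ((fnorm N p f)%:E <= lnorm p g)%E.
Proof.
move=> p0 f0 g0 fg; rewrite -lnorm_trunc//; apply: ler_lnorm => // j.
by case: ifPn => [/fg ->|_]; rewrite ?lexx ?g0 ?lee_fin ?f0.
Qed.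

Lemma lnorm_coord p f j : (0 < p)%E -> (forall i, 0 <= f i)%E ->
  (f j <= lnorm p f)%E.
Proof.
move=> /gt0_ereal[[r r0 ->]|->] f0; last first.
  by move: j; apply/lnorm_oo_le.
rewrite lnorm_EFin//.
rewrite -[leLHS](poweRK r0 (f0 j)).
apply: ler_poweR; rewrite ?poweR_ge0 ?invr_ge0 ?(ltW r0)//.
apply: le_trans (nneseries_lim_ge j.+1 _); last by move=> *; apply: poweR_ge0.
by rewrite big_nat_recr//= leeDr// sume_ge0// => *; apply: poweR_ge0.
Qed.

(** Monotone convergence. For finite [p], a partial sum of length [n] is a limit in [N] of sums
    which, once [N >= n], are bounded by the truncated norm of [g N]. *)
Lemma lnorm_sup p (g : nat -> nat -> R) : (0 < p)%E ->
  (forall N j, 0 <= g N j) -> (forall j, {homo g^~ j : N M / (N <= M)%N >-> N <= M}) ->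
  (lnorm p (fun j => ereal_sup (range (fun N => (g N j)%:E))) <=
   ereal_sup (range (fun N => (fnorm N p (g N))%:E)))%E.
Proof.
move=> p0 g0 gm; set B := ereal_sup _.
have BN N : ((fnorm N p (g N))%:E <= B)%E by apply: ereal_sup_ubound; exists N.
have B0 : (0 <= B)%E by apply: le_trans (BN 0%N); rewrite lee_fin fnorm_ge0.
have G0 j : (0 <= ereal_sup (range (fun N => (g N j)%:E)))%E.
  apply: (@le_trans _ _ (g 0%N j)%:E); first by rewrite lee_fin.
  by apply: ereal_sup_ubound; exists 0%N.
case/gt0_ereal: (p0) => [[r r0 pr]|pr]; last first.
  rewrite pr; apply/lnorm_oo_le => // j; apply: ge_ereal_sup => _ [N _ <-].
  (* The truncation must contain the index [j], hence [j.+1]; raising [N] only increases [g N j]. *)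
  apply: le_trans (BN (maxn N j.+1)); rewrite lee_fin.
  apply: (@le_trans _ _ (g (maxn N j.+1) j)); first by apply: gm; rewrite leq_maxl.
  by apply: le_fnorm_coord => //; rewrite leq_maxr.
rewrite pr lnorm_EFin//.
rewrite -[leRHS](poweRK r0 B0); apply: ler_poweR.
- by rewrite invr_ge0 ltW.
- by apply: nneseries_ge0 => *; apply: poweR_ge0.
apply: lime_le.
  by apply: is_cvg_nneseries => *; apply: poweR_ge0.
apply: nearW => n; rewrite big_mkord.
have cv (k : 'I_n) : (poweR (g N k)%:E r @[N --> \oo] -->
    poweR (ereal_sup (range (fun N => (g N k)%:E))) r)%classic.
  rewrite poweR_sup//; last by move=> N; rewrite lee_fin.
  apply: ereal_nondecreasing_cvgn => N M NM; rewrite !poweR_EFin lee_fin.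
  by apply: ler_powRl; [exact: ltW|exact: g0|exact: gm].
have cvs : ((\sum_(k < n) poweR (g N k)%:E r)%E @[N --> \oo] -->
    (\sum_(k < n) poweR (ereal_sup (range (fun N => (g N k)%:E))) r)%E)%classic.
  apply: cvg_nnesum => k _; last exact: cv.
  by apply: nearW => N; exact: poweR_ge0.
rewrite -(cvg_lim _ cvs)//; apply: lime_le; first exact: cvgP cvs.
near=> N; have nN : (n <= N)%N by near: N; exact: nbhs_infty_ge.
apply: (@le_trans _ _ (poweR (fnorm N r%:E (g N))%:E r)); last first.
  apply: ler_poweR; rewrite ?lee_fin ?fnorm_ge0 ?(ltW r0)//.
  by rewrite -pr.
rewrite poweR_EFin fnorm_powR ?gt_eqF//.
under eq_bigr do rewrite poweR_EFin.
rewrite sumEFin lee_fin -!(big_mkord xpredT (fun k => g N k `^ r)).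
rewrite [leRHS](big_cat_nat (leq0n n) nN)//= lerDl.
by apply: sumr_ge0 => *; apply: powR_ge0.
Unshelve. all: by end_near. Qed.

Lemma le_fmixed_N N M r (a : seq nat -> R) : pos_exps r -> (N <= M)%N ->
  (forall s, 0 <= a s) -> fmixed N r a <= fmixed M r a.
Proof.
move=> + NM; elim: r a => [//|p r IH] a /= /andP[p0 r0] a0.
rewrite -lee_fin -lnorm_trunc//; last by move=> j; apply: fmixed_ge0.
rewrite -lnorm_trunc//; last by move=> j; apply: fmixed_ge0.
apply: ler_lnorm => // j; case: ifPn => jN; last first.
  by case: ifP; rewrite lexx ?lee_fin ?fmixed_ge0.
by rewrite (leq_trans jN NM) !lee_fin fmixed_ge0// IH.
Qed.

Lemma mixed_norm_ge0 r (a : seq nat -> \bar R) : (forall s, 0 <= a s)%E ->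
  (0 <= mixed_norm r a)%E.
Proof. by case: r => //= p r _; exact: lnorm_ge0. Qed.

(** Bounds uniform in the truncation pass to infinite arrays: one use of [lnorm_sup] per index,
    since the inner truncated norms increase with [N]. *)
Lemma mixed_norm_le_sup r (a : seq nat -> R) : pos_exps r -> (forall s, 0 <= a s) ->
  (mixed_norm r (fun s => (a s)%:E) <= ereal_sup (range (fun N => (fmixed N r a)%:E)))%E.
Proof.
elim: r a => [|p r IH] a /=.
  by move=> _ _; apply: ereal_sup_ubound; exists 0%N.
move=> /andP[p0 r0] a0.
apply: le_trans (lnorm_sup p0 _ _).
- apply: ler_lnorm => // j; rewrite mixed_norm_ge0/= => [|s]; last by rewrite lee_fin.
  exact: IH.
- by move=> N j; apply: fmixed_ge0.
- by move=> j N M NM; apply: le_fmixed_N.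
Qed.

Lemma mixed_norm_le r (a : seq nat -> R) (B : R) : pos_exps r ->
  (forall s, 0 <= a s) -> (forall N, fmixed N r a <= B) ->
  (mixed_norm r (fun s => (a s)%:E) <= B%:E)%E.
Proof.
move=> r0 a0 aB; apply: le_trans (mixed_norm_le_sup r0 a0) _.
by apply: ge_ereal_sup => _ [N _ <-]; rewrite lee_fin.
Qed.
End SequenceNorms.

(** * Exponents in the order given by the permutation *)

Definition front_exps (R : realType) n (sigma : {perm 'I_n.+1})
    (p : 'I_n.+1 -> \bar R) : seq (\bar R) :=
  [seq p (sigma (widen_ord (leqnSn n) k)) | k <- enum 'I_n].

Definition trunc (K : nzRingType) (N : nat) (x : nat -> K) : nat -> K :=
  fun k => if (k < N)%N then x k else 0.

Section Exponents.
Context {R : realType}.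

(** Since 1/mu is the maximum of 1/pm and 1/2, subtracting it from 1 gives the minimum in [gap].
    Both sides are infinite when the gap is not positive. *)
Lemma delta_gap (ps : seq (\bar R)) (pm : \bar R) :
  all (fun p => 1 <= p)%E ps -> (1 <= pm)%E ->
  delta (rcons ps (mine pm 2%:E)) = inv_exp (gap ps pm).
Proof.
move=> ps1 pm1; have mu1 : (1 <= mine pm 2%:E)%E.
  by rewrite le_min pm1 lee_fin ler1n.
have muE : invx (mine pm 2%:E) = Num.max (invx pm) 2^-1.
  case/ge1_ereal: pm1 => [[r r1 ->]|->]; last first.
    by rewrite invx_oo min_r ?leey// invx_EFin max_r// invr_ge0.
  rewrite -EFin_min !invx_EFin; case: (leP r 2) => r2.
    by rewrite max_l// lef_pV2 ?posrE//; lra.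
  by rewrite max_r// lef_pV2 ?posrE//; lra.
rewrite /delta; have -> : (\sum_(t <- rcons ps (mine pm 2%:E)) t^-1)%E =
    (\sum_(p <- ps) invx p + Num.max (invx pm) 2^-1)%:E.
  rewrite -cats1 big_cat big_seq1 /= (inve_invx mu1) muE EFinD; congr (_ + _)%E.
  rewrite -sumEFin; elim: ps ps1 => [|p ps IH] /=; first by rewrite !big_nil.
  by move=> /andP[p1 ps1]; rewrite !big_cons (inve_invx p1) IH.
have gE : gap ps pm = 1 - (\sum_(p <- ps) invx p + Num.max (invx pm) 2^-1).
  rewrite /gap; case: (leP (invx pm) 2^-1) => h.
    by rewrite min_r; lra.
  by rewrite min_l; lra.
rewrite -EFinB -gE /inv_exp -EFin_max inver.
by case: (ltP 0 (gap ps pm)) => g0; rewrite ?eqxx// gt_eqF.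
Qed.

Variables (n : nat) (sigma : {perm 'I_n.+1}) (p : 'I_n.+1 -> \bar R).
Hypothesis hp : forall k, (1 <= p k)%E.
Local Notation ps := (front_exps sigma p).
Local Notation pm := (p (sigma ord_max)).

Lemma size_front_exps : size ps = n.
Proof. by rewrite size_map size_enum_ord. Qed.

Lemma front_exps_ge1 : all (fun t => 1 <= t)%E ps.
Proof. by apply/allP => _ /mapP[k _ ->]. Qed.

Lemma nth_all_exps (i : 'I_n.+1) : nth 0%E (rcons ps pm) i = p (sigma i).
Proof.
have -> : rcons ps pm = [seq p (sigma k) | k <- enum 'I_n.+1].
  by rewrite enum_ordSr map_rcons -map_comp.
by rewrite (nth_map i) ?size_enum_ord// nth_ord_enum.
Qed.

Lemma drop_front_exps (i : 'I_n) :
  [seq p (sigma (widen_ord (leqnSn n) k)) | k : 'I_n <- enum 'I_n & (i <= k)%N] =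
  drop i ps.
Proof.
have iotaE j m : (j <= m)%N -> [seq x <- iota 0 m | (j <= x)%N] = drop j (iota 0 m).
  move=> jm; rewrite drop_iota add0n -[in LHS](subnKC jm) iotaD filter_cat add0n.
  rewrite (eq_in_filter (a2 := xpred0)) ?filter_pred0; last first.
    by move=> x; rewrite mem_iota add0n /= => /ltn_geF.
  rewrite (eq_in_filter (a2 := xpredT)) ?filter_predT// => x.
  by rewrite mem_iota => /andP[].
rewrite -map_drop; congr map; apply: (inj_map val_inj).
by rewrite map_drop val_enum_ord -iotaE ?(ltnW (ltn_ord i))// -val_enum_ord filter_map.
Qed.

Lemma exponent_conditionE (q : 'I_n -> \bar R) :
  exponent_condition sigma q p <->
  forall i : 'I_n, (inv_exp (gap (drop i ps) pm) <= q i)%E.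
Proof.
have dE (i : 'I_n) : delta (rcons (drop i ps) (mine pm 2%:E)) =
    inv_exp (gap (drop i ps) pm).
  apply: delta_gap => //; apply/allP => t /mem_drop; exact/allP/front_exps_ge1.
by split=> h i; have := h i; rewrite drop_front_exps dE.
Qed.

Lemma nth_exps (s : seq (\bar R)) (t : \bar R) i : (i <= size s)%N ->
  nth 0%E (exps s t) i =
  if (i < size s)%N then inv_exp (gap (drop i s) t) else inv_exp (1 - invx t).
Proof.
elim: s i => [|x s IH] [|i] //= iS; first exact: IH.
Qed.
End Exponents.

(** * Sufficiency *)

Section Sufficiency.
Context {R : realType} {K : comNzRingType} {absK : K -> R}.
Context {emb : {rmorphism R -> K}} {re im : K -> R}.
Hypothesis HK : modulus absK emb re im.
Variables (n : nat) (sigma : {perm 'I_n.+1}) (p : 'I_n.+1 -> \bar R).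
Hypothesis hp : forall k, (1 <= p k)%E.
Local Notation ps := (front_exps sigma p).
Local Notation pm := (p (sigma ord_max)).

Let p_gt0 k : (0 < p k)%E.
Proof. exact: lt_le_trans (lte01) (hp k). Qed.

Lemma seqnorm_trunc N k (x : nat -> K) :
  seqnorm absK (p k) (trunc N x) = (fnorm N (p k) (fun j => absK (x j)))%:E.
Proof.
rewrite -lnorm_trunc//; last by move=> j; exact: mod_ge0 HK _.
congr lnorm; apply/funext => j; rewrite /trunc; case: ifP => // _.
by rewrite (mod0 HK).
Qed.

Lemma Xspace_trunc N k (x : nat -> K) : Xspace absK (p k) (trunc N x).
Proof.
rewrite /Xspace /=; case: ifP => _; last by rewrite seqnorm_trunc ltry.
apply: cvg_near_cst.
near=> j; rewrite /trunc ltnNge (_ : (N <= j)%N) ?(mod0 HK)//.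
by near: j; exact: nbhs_infty_ge.
Unshelve. all: by end_near. Qed.

(* [A] on the vectors of [l], listed in the order given by [sigma] and truncated
   so that multilinearity holds for all sequences. *)
Definition list_form (N : nat) (A : ('I_n.+1 -> nat -> K) -> K)
    (l : seq (nat -> K)) : K :=
  A (fun k => trunc N (nth (fun=> 0) l ((sigma^-1)%g k))).

Lemma list_form_linear N A : multilinear_form absK p A ->
  forall l1 l2 a u v, (size l1 + size l2)%N = n ->
    list_form N A (l1 ++ (fun j => a * u j + v j) :: l2) =
    a * list_form N A (l1 ++ u :: l2) + list_form N A (l1 ++ v :: l2).
Proof.
move=> Alin l1 l2 a u v sz.
have s1 : (size l1 < n.+1)%N by rewrite ltnS -sz leq_addr.
(* The entry at position [size l1] is the argument in variable [k0], so changing it is the update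
   [dfwith] at [k0]. *)
set k0 := sigma (Ordinal s1).
pose x : 'I_n.+1 -> nat -> K :=
  fun k => trunc N (nth (fun=> 0) (l1 ++ (fun=> 0) :: l2) ((sigma^-1)%g k)).
have xE w : (fun k => trunc N (nth (fun=> 0) (l1 ++ w :: l2) ((sigma^-1)%g k))) =
    @dfwith 'I_n.+1 (fun=> nat -> K) x k0 (trunc N w).
  apply/funext => k; have [<-|kk0] := eqVneq k0 k.
    by rewrite dfwithin /k0 permK /= nth_cat ltnn subnn.
  rewrite dfwithout// /x !nth_cat; case: ltnP => // lt1.
  have : (sigma^-1)%g k != size l1 :> nat.
    apply: contra kk0 => /eqP h; rewrite /k0 -(permKV sigma k).
    by apply/eqP; congr (sigma _); apply: val_inj; rewrite /= h.
  case E : (_ - _)%N => [|//]; move/eqP: E; rewrite subn_eq0 => le1.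
  by rewrite eqn_leq lt1 le1.
rewrite /list_form !xE.
have -> : trunc N (fun j => a * u j + v j) =
    (fun j => a * trunc N u j + trunc N v j).
  by apply/funext => j; rewrite /trunc; case: ifP => // _; rewrite mulr0 addr0.
apply: Alin; [|exact: Xspace_trunc..].
by move=> k; exact: Xspace_trunc.
Qed.

Lemma list_form_bound N A (M : R) : form_norm absK p A = M%:E ->
  forall l, in_balls (absK := absK) N (rcons ps pm) l -> absK (list_form N A l) <= M.
Proof.
move=> AM l; rewrite /in_balls all2E => /andP[/eqP sz al].
rewrite -lee_fin -AM; apply: ereal_sup_ubound; exists
  (fun k => trunc N (nth (fun=> 0) l ((sigma^-1)%g k))) => //; split.
  by move=> k; exact: Xspace_trunc.
move=> k; rewrite seqnorm_trunc lee_fin.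
have := nth_all_exps sigma p ((sigma^-1)%g k); rewrite permKV => <-.
rewrite size_rcons size_front_exps in sz.
move/all_nthP: al => /(_ (0%E, fun=> 0) ((sigma^-1)%g k)).
rewrite size_zip size_rcons size_front_exps -sz minnn nth_zip ?size_rcons ?size_front_exps//=.
exact.
Qed.

Lemma form_coef_list N A (s : seq nat) : size s = n.+1 ->
  all (fun j => j < N)%N s ->
  form_coef absK sigma A s = (absK (list_form N A (map (unit_vec K) s)))%:E.
Proof.
move=> sz /allP sN; rewrite /form_coef /list_form; congr (absK (A _))%:E.
apply/funext => k; have ks : ((sigma^-1)%g k < size s)%N by rewrite sz.
rewrite (nth_map 0%N)//; apply/funext => j; rewrite /trunc /unit_vec.
case: ifPn => //; rewrite -leqNgt => Nj; case: eqP => // jE.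
by have := sN _ (mem_nth 0%N ks); rewrite -jE ltnNge Nj.
Qed.

Lemma exponent_condition_sufficient (q : 'I_n -> \bar R) :
  exponent_condition sigma q p -> anisotropic_ineq absK sigma q p.
Proof.
move=> /exponent_conditionE-/(_ hp) qE.
have [C C0 HC] := finite_inequality HK (front_exps_ge1 sigma hp) (hp (sigma ord_max)).
(* Being positive, this constant also settles the case of an infinite [form_norm]. *)
exists (Num.max C 1); first by rewrite le_max lexx orbT.
move=> A Alin _.
have N0 : (0 <= form_norm absK p A)%E.
  apply: (@le_trans _ _ (absK (A (fun=> trunc 0 (fun=> 0))))%:E).
    by rewrite lee_fin (mod_ge0 HK).
  apply: ereal_sup_ubound; exists (fun=> trunc 0 (fun=> 0)) => //; split.
    by move=> k; exact: Xspace_trunc.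
  move=> k; rewrite seqnorm_trunc lee_fin; case/ge1_ereal: (hp k) => [[r r1 ->]|->].
    by rewrite /fnorm big_ord0 powR0// invr_neq0// gt_eqF//; lra.
  by apply: fnorm_oo_le.
case AM : (form_norm absK p A) N0 => [M||] //; last first.
  by rewrite gt0_muley ?leey// lte_fin lt_max ltr01 orbT.
rewrite lee_fin => M0; rewrite -EFinM.
pose a s := fine (form_coef absK sigma A s).
have a0 s : 0 <= a s by exact: mod_ge0 HK _.
rewrite (_ : form_coef absK sigma A = fun s => (a s)%:E)//.
set qs := rcons _ _.
have sq : size qs = n.+1 by rewrite size_rcons size_map size_enum_ord.
have qsE i : (nth 0%E (exps ps pm) i <= nth 0%E qs i)%E.
  have [ni|ni] := ltnP n i.
    by rewrite !nth_default ?sq ?size_exps ?size_front_exps.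
  rewrite nth_exps ?size_front_exps// /qs nth_rcons size_map size_enum_ord.
  case: ltnP => [iN|Ni].
    rewrite (nth_map (Ordinal iN)) ?size_enum_ord//.
    by rewrite (nth_ord_enum (Ordinal iN) (Ordinal iN)); exact: qE (Ordinal iN).
  by rewrite eqn_leq ni Ni hoelder_conjugateE.
apply: mixed_norm_le => //.
  apply/(all_nthP 0%E) => i; rewrite sq => iq; apply: lt_le_trans (qsE i).
  by move/(all_nthP 0%E): (pos_exps_exps ps pm); apply; rewrite size_exps size_front_exps.
move=> N; apply: le_trans (fmixed_anti N _ (pos_exps_exps ps pm) qsE a0) _.
  by rewrite sq size_exps size_front_exps.
(* For indices below [N], truncation does not change the unit vectors. *)
rewrite (eq_fmixed_lt (b := fun s => absK (list_form N A (map (unit_vec K) s)))).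
  apply: le_trans (HC N (list_form N A) M M0 _ _) _.
  - by move=> *; apply: list_form_linear => //; rewrite -[RHS](size_front_exps sigma p).
  - exact: list_form_bound.
  - by rewrite ler_wpM2r// le_max lexx.
move=> s; rewrite size_exps size_front_exps => ss sN.
by rewrite /a (form_coef_list A ss sN).
Qed.
End Sufficiency.

(** * Necessity *)

Section CoordinateForms.
Context {R : realType} {K : comNzRingType} {absK : K -> R}.
Context {emb : {rmorphism R -> K}} {re im : K -> R}.
Hypothesis HK : modulus absK emb re im.
Context {m : nat}.
Implicit Types (F G : ('I_m -> nat -> K) -> K).

(** Continuity for the uniform distance of coordinates makes sense without reference to the
    exponents. It implies continuity on every product of the X_p, because each norm dominates every
    coordinate. *)
Definition coord_continuous F := forall x (e : R), 0 < e ->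
  exists2 d : R, 0 < d & forall y, (forall k j, absK (y k j - x k j) < d) ->
    absK (F y - F x) < e.

Lemma coord_continuous_cst c : coord_continuous (fun=> c).
Proof. by move=> x e e0; exists 1 => // y _; rewrite subrr (mod0 HK). Qed.

Lemma coord_continuous_coord k j : coord_continuous (fun x => x k j).
Proof. by move=> x e e0; exists e. Qed.

Lemma coord_continuousD F G : coord_continuous F -> coord_continuous G ->
  coord_continuous (fun x => F x + G x).
Proof.
move=> cF cG x e e0; have e2 : 0 < e / 2 by rewrite divr_gt0.
have [d d0 hF] := cF x _ e2; have [d' d'0 hG] := cG x _ e2.
exists (Num.min d d'); first by rewrite lt_min d0.
move=> y hy; rewrite (_ : _ - _ = (F y - F x) + (G y - G x)); last by ring.
apply: le_lt_trans (mod_le HK _ _) _.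
have h1 : absK (F y - F x) < e / 2.
  by apply: hF => k j; apply: lt_le_trans (hy k j) _; rewrite ge_min lexx.
have h2 : absK (G y - G x) < e / 2.
  by apply: hG => k j; apply: lt_le_trans (hy k j) _; rewrite ge_min lexx orbT.
lra.
Qed.

Lemma coord_continuousM F G : coord_continuous F -> coord_continuous G ->
  coord_continuous (fun x => F x * G x).
Proof.
move=> cF cG x e e0.
have f0 := mod_ge0 HK (F x); have g0 := mod_ge0 HK (G x).
set f := absK (F x) in f0 *; set g := absK (G x) in g0 *.
have f1 : 0 < 2 * (1 + f) by lra.
have g1 : 0 < 2 * (1 + g) by lra.
(* Write the increment of the product as dF dG + dF G + F dG. As |dG| < 1, the first two terms total
   at most |dF| (1 + g) < e / 2; the last is below e / 2. *)
have ef : 0 < Num.min 1 (e / (2 * (1 + f))) by rewrite lt_min ltr01 divr_gt0.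
have [d d0 hF] := cF x _ (divr_gt0 e0 g1).
have [d' d'0 hG] := cG x _ ef.
exists (Num.min d d'); first by rewrite lt_min d0.
move=> y hy.
have : absK (F y - F x) < e / (2 * (1 + g)).
  by apply: hF => k j; apply: lt_le_trans (hy k j) _; rewrite ge_min lexx.
rewrite ltr_pdivlMr//.
have : absK (G y - G x) < Num.min 1 (e / (2 * (1 + f))).
  by apply: hG => k j; apply: lt_le_trans (hy k j) _; rewrite ge_min lexx orbT.
rewrite lt_min ltr_pdivlMr// => /andP[hG1 hGf] hFg.
rewrite (_ : F y * G y - F x * G x =
  (F y - F x) * (G y - G x) + ((F y - F x) * G x + F x * (G y - G x))); last by ring.
have := mod_le HK ((F y - F x) * (G y - G x)) ((F y - F x) * G x + F x * (G y - G x)).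
have := mod_le HK ((F y - F x) * G x) (F x * (G y - G x)).
rewrite !(modM HK) -/f -/g.
have dF0 := mod_ge0 HK (F y - F x); have dG0 := mod_ge0 HK (G y - G x).
set a := absK (F y - F x) in hFg dF0 *; set b := absK (G y - G x) in hG1 hGf dG0 *.
have ab : a * b <= a by rewrite ler_piMr// ltW.
move=> h1 h2; apply: le_lt_trans h2 _; nra.
Qed.

Lemma coord_continuous_form (p : 'I_m -> \bar R) F : (forall k, 1 <= p k)%E ->
  coord_continuous F -> continuous_form absK p F.
Proof.
move=> hp cF x _ e e0; have [d d0 hd] := cF x e e0; exists d => // y _ hy.
apply: hd => k j; rewrite -lte_fin; apply: le_lt_trans (hy k).
apply: (@lnorm_coord _ (p k) (fun j => (absK (y k j - x k j))%:E)).
  exact: lt_le_trans (hp k).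
by move=> i; rewrite lee_fin (mod_ge0 HK).
Qed.

Definition coord_form (J : finType) (c : J -> K) (f : J -> 'I_m -> nat)
    (x : 'I_m -> nat -> K) : K :=
  \sum_(a : J) c a * \prod_k x k (f a k).

Lemma coord_form_continuous (p : 'I_m -> \bar R) (J : finType) (c : J -> K)
    (f : J -> 'I_m -> nat) : (forall k, 1 <= p k)%E ->
  continuous_form absK p (coord_form c f).
Proof.
move=> hp; apply: coord_continuous_form => //; rewrite /coord_form.
elim: (index_enum J) => [|a r IH].
  rewrite (_ : (fun x => _) = fun=> 0); last by apply/funext => x; rewrite big_nil.
  exact: coord_continuous_cst.
under eq_fun do rewrite big_cons.
apply: coord_continuousD IH; apply: coord_continuousM; first exact: coord_continuous_cst.
elim: (index_enum 'I_m) => [|k s IHs].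
  rewrite (_ : (fun x => _) = fun=> 1); last by apply/funext => x; rewrite big_nil.
  exact: coord_continuous_cst.
under eq_fun do rewrite big_cons.
by apply: coord_continuousM IHs; exact: coord_continuous_coord.
Qed.

Lemma coord_form_multilinear (p : 'I_m -> \bar R) (J : finType) (c : J -> K)
    (f : J -> 'I_m -> nat) : multilinear_form absK p (coord_form c f).
Proof.
move=> x k a u v _ _ _; rewrite /coord_form mulr_sumr -big_split /=.
apply: eq_bigr => b _.
have pE w : \prod_i (@dfwith 'I_m (fun=> nat -> K) x k w) i (f b i) =
    w (f b k) * \prod_(i | i != k) x i (f b i).
  rewrite (bigD1 k)//= dfwithin; congr (_ * _); apply: eq_bigr => i ik.
  by rewrite dfwithout// eq_sym.
by rewrite !pE; ring.
Qed.
End CoordinateForms.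

(** * Coefficients and norms of the test forms *)

Section TestForm.
Context {R : realType} {K : comNzRingType} {absK : K -> R}.
Context {emb : {rmorphism R -> K}} {re im : K -> R}.
Hypothesis HK : modulus absK emb re im.
Variables (n : nat) (sigma : {perm 'I_n.+1}) (p : 'I_n.+1 -> \bar R).
Variables (q : 'I_n -> \bar R).
Hypothesis hp : forall k, (1 <= p k)%E.
Hypothesis hq : forall i, (0 < q i)%E.
Local Notation pc := (hoelder_conjugate (p (sigma ord_max))).

(** Each norm dominates every single coordinate. This serves both to freeze leading indices at 0 and
    to restrict later ones to a diagonal. *)
Lemma mixed_norm_cat (r1 r2 : seq (\bar R)) j (a : seq nat -> \bar R) :
  pos_exps r1 -> (forall s, 0 <= a s)%E ->
  (mixed_norm r2 (fun s => a (nseq (size r1) j ++ s)) <= mixed_norm (r1 ++ r2) a)%E.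
Proof.
elim: r1 a => [//|t r1 IH] a /= /andP[t0 r10] a0.
apply: le_trans (IH (fun s => a (j :: s)) r10 (fun s => a0 _)) _.
apply: (@lnorm_coord _ t (fun j => mixed_norm (r1 ++ r2) (fun s => a (j :: s)))) => // i.
exact: mixed_norm_ge0.
Qed.

(* The index at position [t] in the order given by [sigma]: the positions before
   [i] are frozen at [0], the last one runs over [l]. *)
Definition test_index (i : nat) (j l : nat) (t : nat) : nat :=
  if (t < i)%N then 0%N else if (t < n)%N then j else l.

Definition test_form (i N : nat) (h : nat -> nat -> R) : ('I_n.+1 -> nat -> K) -> K :=
  coord_form (fun a : 'I_N * 'I_N => emb (h a.1 a.2))
    (fun a k => test_index i a.1 a.2 ((sigma^-1)%g k)).

Lemma test_form_coef (i : 'I_n) N h j l : (j < N)%N -> (l < N)%N ->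
  form_coef absK sigma (test_form i N h)
    (nseq i 0%N ++ j :: nseq (n - i.+1) j ++ [:: l]) = `|h j l|%:E.
Proof.
move=> jN lN; rewrite /form_coef -(mod_emb HK); congr (absK _)%:E.
have nthE (t : 'I_n.+1) : nth 0%N (nseq i 0%N ++ j :: nseq (n - i.+1) j ++ [:: l]) t =
    test_index i j l t.
  rewrite /test_index nth_cat size_nseq; case: ltnP => it.
    by rewrite nth_nseq it.
  rewrite -cat_cons -[j :: nseq _ _]/(nseq (n - i.+1).+1 j).
  rewrite nth_cat size_nseq nth_nseq subnSK// ltn_subLR ?subnKC ?(ltnW (ltn_ord i))//.
  case: ltnP => // nt.
  have -> : t = n :> nat by apply/eqP; rewrite eqn_leq nt -ltnS ltn_ord.
  by rewrite subnn.
rewrite (_ : (fun k => unit_vec K _) =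
    fun k => unit_vec K (test_index i j l ((sigma^-1)%g k))); last first.
  by apply/funext => k; rewrite nthE.
rewrite /test_form /coord_form.
rewrite (bigD1 (Ordinal jN, Ordinal lN))//= [X in _ + X]big1 => [|[j' l'] jl].
  rewrite big1 ?mulr1 ?addr0// => k _.
  by rewrite /unit_vec /= eqxx.
apply/eqP; move: jl; apply: contraR => nz.
have eqk (k : 'I_n.+1) : test_index i j' l' ((sigma^-1)%g k) =
    test_index i j l ((sigma^-1)%g k).
  apply/eqP; apply: contraR nz => ne; rewrite (bigD1 k)//=.
  by rewrite /unit_vec /= (negbTE ne) mul0r mulr0.
(* Position [i] carries the first index and the last position the second, so a nonzero monomial
   determines the pair. *)
have := eqk (sigma (widen_ord (leqnSn n) i)); have := eqk (sigma ord_max).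
rewrite !permK /test_index /= ltnn (ltn_ord i) ltnn.
rewrite ltnNge (ltnW (ltn_ord i)) /= => ll jj.
by rewrite -pair_eqE /pair_eq /= -!val_eqE /= jj ll !eqxx.
Qed.

(** Freeze the positions before [i] at 0 and let those strictly between [i] and the last equal the
    index [j] at [i]. What remains is the l_r-norm over [j] of the row norms of [h]. *)
Lemma test_form_lower (i : 'I_n) N h (r H : R) : 0 < r -> q i = r%:E -> 0 <= H ->
  (forall j, (j < N)%N -> H <= fnorm N pc (fun l => `|h j l|)) ->
  ((N%:R `^ r^-1 * H)%:E <=
    mixed_norm (rcons [seq q k | k <- enum 'I_n] pc)
      (form_coef absK sigma (test_form i N h)))%E.
Proof.
move=> r0 qi H0 hH; set a := form_coef _ _ _.
have a0 s : (0 <= a s)%E by rewrite lee_fin (mod_ge0 HK).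
have pc0 : (0 < pc)%E by rewrite hoelder_conjugateE// inv_exp_gt0.
set qs := [seq q k | k <- enum 'I_n].
have sq : size qs = n by rewrite size_map size_enum_ord.
have q0 : pos_exps qs by apply/allP => _ /mapP[k _ ->].
have -> : rcons qs pc = take i qs ++ r%:E :: (drop i.+1 qs ++ [:: pc]).
  rewrite -cats1 -[in LHS](cat_take_drop i qs) -catA; congr (_ ++ _).
  rewrite (drop_nth 0%E) ?sq//= (nth_map i) ?size_enum_ord// nth_ord_enum qi.
  by [].
have /andP[tq0 dq0] : pos_exps (take i qs) && pos_exps (drop i qs).
  by rewrite /pos_exps -all_cat cat_take_drop.
apply: le_trans (mixed_norm_cat _ 0%N tq0 a0).
rewrite size_take sq ltn_ord.
have -> : N%:R `^ r^-1 * H = fnorm N r%:E (fun=> H).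
  rewrite /fnorm /= sumr_const card_ord -[in RHS]mulr_natl powRM ?powR_ge0//.
  by rewrite powRK// gt_eqF.
apply: fnorm_le_lnorm => // [j|j jN]; first exact: mixed_norm_ge0.
apply: le_trans (mixed_norm_cat _ j _ _) => //; last first.
  by rewrite /pos_exps; move: dq0; rewrite (drop_nth 0%E) ?sq//= => /andP[].
rewrite size_drop sq /=.
apply: (@le_trans _ _ (fnorm N pc (fun l => `|h j l|))%:E).
  by rewrite lee_fin hH.
apply: fnorm_le_lnorm => // l lN.
by rewrite /a -(test_form_coef i h jN lN).
Qed.

Lemma test_form_upper (i : 'I_n) N (h : nat -> nat -> R) (D : R) :
  (forall x : 'I_n.+1 -> nat -> K,
    (forall k M, fnorm M (p k) (fun j => absK (x k j)) <= 1) ->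
    \sum_(j < N) (\prod_(t < n | (i <= t)%N)
                    absK (x (sigma (widen_ord (leqnSn n) t)) j) *
      absK (\sum_(l < N) emb (h j l) * x (sigma ord_max) l)) <= D) ->
  (form_norm absK p (test_form i N h) <= D%:E)%E.
Proof.
move=> hD; apply: ge_ereal_sup => _ [x [_ x1] <-]; rewrite lee_fin.
have xM k M : fnorm M (p k) (fun j => absK (x k j)) <= 1.
  rewrite -lee_fin; apply: le_trans (x1 k).
  apply: fnorm_le_lnorm => //; [exact: lt_le_trans (hp k)|..].
  - by move=> j; exact: mod_ge0 HK _.
  - by move=> j; rewrite lee_fin (mod_ge0 HK).
apply: le_trans (hD x xM).
pose P0 := \prod_(t < n | (t < i)%N) x (sigma (widen_ord (leqnSn n) t)) 0%N.
pose z j := \prod_(t < n | (i <= t)%N) x (sigma (widen_ord (leqnSn n) t)) j.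
have -> : test_form i N h x =
    P0 * \sum_(j < N) (z j * \sum_(l < N) emb (h j l) * x (sigma ord_max) l).
  rewrite /test_form /coord_form mulr_sumr.
  rewrite -(pair_bigA _ (fun j l : 'I_N => emb (h j l) *
     \prod_k x k (test_index i j l ((sigma^-1)%g k)))) /=.
  apply: eq_bigr => j _; rewrite mulrA mulr_sumr; apply: eq_bigr => l _.
  rewrite (reindex_inj (@perm_inj _ sigma)) /=.
  under eq_bigr do rewrite permK.
  rewrite big_ord_recr /= (bigID (fun t : 'I_n => (t < i)%N)) /=.
  have -> : \prod_(t < n | (t < i)%N) x (sigma (widen_ord (leqnSn n) t))
      (test_index i j l t) = P0.
    by apply: eq_bigr => t ti; rewrite /test_index ti.
  have -> : \prod_(t < n | ~~ (t < i)%N) x (sigma (widen_ord (leqnSn n) t))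
      (test_index i j l t) = z j.
    apply: eq_big => [t|t /negbTE ti]; first by rewrite -leqNgt.
    by rewrite /test_index ti ltn_ord.
  rewrite /test_index ltnNge (ltnW (ltn_ord i)) /= ltnn; ring.
rewrite (modM HK); apply: (@le_trans _ _ (1 * absK
   (\sum_(j < N) (z j * \sum_(l < N) emb (h j l) * x (sigma ord_max) l)))).
  apply: ler_wpM2r; first exact: mod_ge0 HK _.
  rewrite (mod_prod HK); apply: prodr_ile1 => t _; rewrite (mod_ge0 HK) /=.
  set k := sigma _; apply: le_trans (xM k 1%N).
  apply: (@le_fnorm_coord _ 1%N (p k) (fun j => absK (x k j))) => //.
    exact: lt_le_trans (hp k).
  by move=> j; exact: mod_ge0 HK _.
rewrite mul1r; apply: le_trans (mod_sum HK _ _ _) _; apply: ler_sum => j _.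
by rewrite (modM HK) (mod_prod HK).
Qed.

Lemma test_form_ineq (C : R) (i : 'I_n) N (h : nat -> nat -> R) (r H D : R) :
  (forall A : ('I_n.+1 -> nat -> K) -> K,
    multilinear_form absK p A -> continuous_form absK p A ->
    (mixed_norm (rcons [seq q i | i <- enum 'I_n] pc) (form_coef absK sigma A)
       <= C%:E * form_norm absK p A)%E) ->
  0 <= C -> 0 < r -> q i = r%:E -> 0 <= H ->
  (forall j, (j < N)%N -> H <= fnorm N pc (fun l => `|h j l|)) ->
  (forall x : 'I_n.+1 -> nat -> K,
    (forall k M, fnorm M (p k) (fun j => absK (x k j)) <= 1) ->
    \sum_(j < N) (\prod_(t < n | (i <= t)%N)
                    absK (x (sigma (widen_ord (leqnSn n) t)) j) *
      absK (\sum_(l < N) emb (h j l) * x (sigma ord_max) l)) <= D) ->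
  N%:R `^ r^-1 * H <= C * D.
Proof.
move=> hA C0 r0 qi H0 hH hD; rewrite -lee_fin [leRHS]EFinM.
apply: le_trans (test_form_lower r0 qi H0 hH) _.
apply: le_trans (hA _ _ _) _.
- exact: coord_form_multilinear.
- by apply: (coord_form_continuous HK).
- by apply: lee_wpmul2l; rewrite ?lee_fin//; apply: test_form_upper.
Qed.
End TestForm.

(** * Estimates for the identity and Hadamard matrices *)

Section Necessity.
Context {R : realType}.

(** A Hölder inequality valid also when the reciprocals [c * u k] total more than 1: rescale them to
    total at most 1, give the missing weight to the constant 1/N, and sum the weighted AM-GM
    inequality over [j]. *)
Lemma sum_prod_le (I : Type) (r : seq I) N (c : R) (u : I -> R) (t : I -> nat -> R) :
  0 < c -> (forall k, 0 <= u k) -> (forall k j, 0 <= t k j) ->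
  (forall k, exists w : nat -> R, [/\ forall j, 0 <= w j, \sum_(j < N) w j <= 1 &
    forall j, (j < N)%N -> t k j <= w j `^ u k]) ->
  \sum_(j < N) \prod_(k <- r) t k j `^ c <=
  N%:R `^ Num.max 0 (1 - c * \sum_(k <- r) u k).
Proof.
move=> c0 u0 t0 /choice[w hw].
case: N => [|N] in hw *; first by rewrite big_ord0 powR_ge0.
have w0 k j : 0 <= w k j by have [] := hw k.
set U := c * \sum_(k <- r) u k.
have U0 : 0 <= U by rewrite mulr_ge0 ?(ltW c0)// sumr_ge0.
pose V := Num.max 1 U; have V1 : 1 <= V by rewrite le_max lexx.
have V0 : 0 < V by lra.
pose th k := c * u k / V.
have th0 k : 0 <= th k by rewrite divr_ge0 ?mulr_ge0 ?(ltW c0) ?(ltW V0).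
have sth : \sum_(k <- r) th k = U / V by rewrite /U mulr_sumr mulr_suml.
have UV : U / V <= 1 by rewrite ler_pdivrMr// mul1r le_max lexx orbT.
have -> : Num.max 0 (1 - U) = 1 - U / V.
  rewrite /V; case: (leP 1 U) => U1; last by rewrite max_r ?divr1//; lra.
  by rewrite max_l ?divff ?subrr//; lra.
set M := N.+1%:R; have M0 : 0 < M :> R by rewrite ltr0n.
(* In the index type [option I], [None] is the extra constant factor [M^-1] with weight
   [1 - U / V]. *)
have key (j : 'I_N.+1) : M^-1 `^ (1 - U / V) * \prod_(k <- r) t k j `^ c <=
    (1 - U / V) * M^-1 + \sum_(k <- r) th k * w k j.
  have := @weighted_amgm R (option I) (None :: map Some r)
    (oapp th (1 - U / V)) (oapp (fun k => w k j) M^-1).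
  rewrite !big_cons !big_map /= sth subrK => /(_ _ _ erefl)h.
  apply: le_trans (h _ _).
  - rewrite ler_wpM2l ?powR_ge0//; apply: ler_prod => k _.
    rewrite powR_ge0 /=; have [_ w1 tw] := hw k.
    apply: (@le_trans _ _ ((w k j `^ u k) `^ c)).
      by apply: ler_powRl; [exact: ltW|exact: t0|exact: tw].
    rewrite -powRrM mulrC; have := w0 k j; rewrite le_eqVlt => /predU1P[wE|wp].
      rewrite -wE /th; have [->|ne] := eqVneq (c * u k) 0; first by rewrite mul0r.
      by rewrite powR0// powR_ge0.
    (* As [w k j <= 1], lowering the exponent from [c * u k] to [th k] can only increase the
       power. *)
    apply: ger_powR.
      rewrite wp; apply: le_trans w1; rewrite (bigD1 j)//= lerDl.
      by apply: sumr_ge0.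
    by rewrite ler_pdivrMr// ler_peMr// mulr_ge0// ltW.
  - by case=> [k|] /=; rewrite ?subr_ge0.
  - by case=> [k|] /=; rewrite ?w0// invr_ge0 ltW.
have : \sum_(j < N.+1) (M^-1 `^ (1 - U / V) * \prod_(k <- r) t k j `^ c) <= 1.
  apply: le_trans (ler_sum _ (fun j _ => key j)) _.
  rewrite big_split /= sumr_const card_ord -mulrnAr -mulr_natl divff ?gt_eqF// mulr1.
  rewrite exchange_big /= -lerBrDl opprB addrC subrK -sth.
  apply: ler_sum => k _; rewrite -mulr_sumr ler_piMr//.
  by have [] := hw k.
rewrite -mulr_sumr -powR_inv1 ?(ltW M0)// -powRrM mulN1r powRN.
by rewrite ler_pdivrMl ?powR_gt0// mulr1.
Qed.

(** Represents points of the unit ball as powers of weights, the form required by [sum_prod_le]. For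
    infinite [p] the zero weight works because 0^0 = 1. *)
Lemma fnorm_weight N (p : \bar R) (t : nat -> R) : (1 <= p)%E ->
  (forall j, 0 <= t j) -> fnorm N p t <= 1 ->
  exists w : nat -> R, [/\ forall j, 0 <= w j, \sum_(j < N) w j <= 1 &
    forall j, (j < N)%N -> t j <= w j `^ invx p].
Proof.
move=> p1 t0 t1; have p0 : (0 < p)%E by apply: lt_le_trans p1.
case/ge1_ereal: (p1) => [[r r1 pE]|pE].
  have r0 : 0 < r by lra.
  exists (fun j => t j `^ r); split=> [j||j jN]; first exact: powR_ge0.
    rewrite -(fnorm_powR _ _ (_ : r != 0)) ?gt_eqF// -pE.
    apply: (@le_trans _ _ (1 `^ r)); last by rewrite powR1.
    by apply: ler_powRl; rewrite ?fnorm_ge0 ?pE ?(ltW r0)// -pE.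
  by rewrite pE invx_EFin powRK// gt_eqF.
exists (fun=> 0); split=> // [|j jN]; first by rewrite sumr_const mul0rn ler01.
rewrite pE invx_oo powRr0; apply: le_trans t1.
exact: (le_fnorm_coord p0).
Qed.

Lemma cauchy_schwarz_sum (I : Type) (r : seq I) (f g : I -> R) (X Y : R) :
  0 < X -> 0 < Y -> \sum_(i <- r) f i ^+ 2 <= X ^+ 2 ->
  \sum_(i <- r) g i ^+ 2 <= Y ^+ 2 -> \sum_(i <- r) f i * g i <= X * Y.
Proof.
move=> X0 Y0 fX gY.
have : 0 <= \sum_(i <- r) (f i / X - g i / Y) ^+ 2.
  by apply: sumr_ge0 => i _; apply: sqr_ge0.
have -> : \sum_(i <- r) (f i / X - g i / Y) ^+ 2 =
    (\sum_(i <- r) f i ^+ 2) / X ^+ 2 + (\sum_(i <- r) g i ^+ 2) / Y ^+ 2 -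
    2 * ((\sum_(i <- r) f i * g i) / (X * Y)).
  rewrite !mulr_suml mulr_sumr -big_split -sumrB /=; apply: eq_bigr => i _.
  by field; rewrite !gt_eqF.
have : (\sum_(i <- r) f i ^+ 2) / X ^+ 2 <= 1.
  by rewrite ler_pdivrMr ?mul1r// exprn_gt0.
have : (\sum_(i <- r) g i ^+ 2) / Y ^+ 2 <= 1.
  by rewrite ler_pdivrMr ?mul1r// exprn_gt0.
move=> h1 h2 h3; have : (\sum_(i <- r) f i * g i) / (X * Y) <= 1 by lra.
by rewrite ler_pdivrMr ?mul1r// mulr_gt0.
Qed.

(** Only powers of 2 are used, since these are the orders of the Hadamard matrices at hand. *)
Lemma powR_unbounded (d C : R) : 0 < d -> exists k, C < (2 ^ k)%:R `^ d.
Proof.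
move=> d0; pose e := d * ln 2; have e0 : 0 < e.
  by rewrite mulr_gt0// ln_gt0// ltr1n.
have [k kC] : exists k : nat, C < k%:R * e.
  exists (Num.Def.trunc (`|C| / e)).+1.
  apply: le_lt_trans (ler_norm C) _; rewrite -ltr_pdivrMr//.
  exact: Num.Theory.truncnS_gt.
exists k; rewrite /powR pnatr_eq0 expn_eq0 /= natrX lnXn ?ltr0n//.
rewrite -[ln _ *+ _]mulr_natl mulrCA -/e.
by apply: lt_le_trans (expR_ge1Dx _); lra.
Qed.

(* Sylvester's Hadamard matrix of order [2 ^ k] *)
Fixpoint sylvester (k : nat) (j l : nat) : R :=
  if k is k'.+1 then
    (if (2 ^ k' <= j)%N && (2 ^ k' <= l)%N then -1 else 1) *
    sylvester k' (j %% 2 ^ k') (l %% 2 ^ k')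
  else 1.

Lemma norm_sylvester k j l : `|sylvester k j l| = 1.
Proof.
elim: k j l => [|k IH] j l /=; first by rewrite normr1.
by rewrite normrM IH mulr1; case: ifP => _; rewrite ?normrN1 ?normr1.
Qed.

Section Scalars.
Context {K : comNzRingType} {absK : K -> R}.
Context {emb : {rmorphism R -> K}} {re im : K -> R}.
Hypothesis HK : modulus absK emb re im.

Lemma parallelogram x y :
  absK (x + y) ^+ 2 + absK (x - y) ^+ 2 = 2 * (absK x ^+ 2 + absK y ^+ 2).
Proof.
have [_ reN] := coordE (reD HK); have [_ imN] := coordE (imD HK).
by rewrite !(mod_sqr HK) !(reD HK) !(imD HK) reN imN; ring.
Qed.

(** The matrix is orthogonal up to the factor 2^(k/2). Splitting it into blocks H, H, H, -H turns
    the induction step into the parallelogram identity. *)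
Lemma sylvester_energy k (y : nat -> K) :
  \sum_(j < 2 ^ k) absK (\sum_(l < 2 ^ k) emb (sylvester k j l) * y l) ^+ 2 =
  (2 ^ k)%:R * \sum_(l < 2 ^ k) absK (y l) ^+ 2.
Proof.
elim: k y => [|k IH] y.
  by rewrite !big_ord1 rmorph1 !mul1r.
set m := (2 ^ k)%N; have m0 : (0 < m)%N by rewrite expn_gt0.
rewrite expnS mul2n -addnn -/m.
pose a j := \sum_(l < m) emb (sylvester k j l) * y l.
pose b j := \sum_(l < m) emb (sylvester k j l) * y (m + l)%N.
have lo (j : 'I_m) : \sum_(l < m + m) emb (sylvester k.+1 j l) * y l = a j + b j.
  rewrite big_split_ord /=; congr (_ + _); apply: eq_bigr => l _;
    rewrite /= -/m leqNgt ltn_ord /= mul1r modn_small//.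
    by rewrite modn_small.
  by rewrite modnDl modn_small.
have hi (j : 'I_m) : \sum_(l < m + m) emb (sylvester k.+1 (m + j) l) * y l = a j - b j.
  rewrite big_split_ord /= -sumrN; congr (_ + _); apply: eq_bigr => l _;
    rewrite /= -/m leq_addr /= modnDl modn_small//.
    by rewrite leqNgt ltn_ord mul1r modn_small.
  by rewrite leq_addr mulN1r modnDl modn_small// rmorphN mulNr.
rewrite big_split_ord /=.
under eq_bigr do rewrite lo.
under [in X in _ + X]eq_bigr do rewrite hi.
rewrite -big_split /=; under eq_bigr do rewrite parallelogram.
rewrite -mulr_sumr big_split /= IH (IH (fun l => y (m + l)%N)) -/m.
rewrite [in RHS]big_split_ord /= natrD; ring.
Qed.
End Scalars.
End Necessity.

(** * Necessity of the exponent condition *)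

Section NecessityTheorem.
Context {R : realType} {K : comNzRingType} {absK : K -> R}.
Context {emb : {rmorphism R -> K}} {re im : K -> R}.
Hypothesis HK : modulus absK emb re im.
Variables (n : nat) (sigma : {perm 'I_n.+1}) (p : 'I_n.+1 -> \bar R).
Variables (q : 'I_n -> \bar R).
Hypothesis hp : forall k, (1 <= p k)%E.
Hypothesis hq : forall i, (0 < q i)%E.
Local Notation ps := (front_exps sigma p).
Local Notation pm := (p (sigma ord_max)).
Local Notation widen t := (widen_ord (leqnSn n) t).

Lemma sum_drop_front_exps (i : 'I_n) (f : \bar R -> R) :
  \sum_(t <- drop i ps) f t = \sum_(t < n | (i <= t)%N) f (p (sigma (widen t))).
Proof. by rewrite -drop_front_exps big_map big_filter big_enum_cond. Qed.

Let coords (x : 'I_n.+1 -> nat -> K) (k : 'I_n.+1) j := absK (x (sigma k) j).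

Let coords_weight x N k : (forall k M, fnorm M (p k) (fun j => absK (x k j)) <= 1) ->
  exists w : nat -> R, [/\ forall j, 0 <= w j, \sum_(j < N) w j <= 1 &
    forall j, (j < N)%N -> coords x k j <= w j `^ invx (p (sigma k))].
Proof.
move=> x1; apply: fnorm_weight => //.
by move=> j; exact: mod_ge0 HK _.
Qed.

Let prod_bound (r : seq 'I_n.+1) x N (c : R) : 0 < c ->
  (forall k M, fnorm M (p k) (fun j => absK (x k j)) <= 1) ->
  \sum_(j < N) \prod_(k <- r) coords x k j `^ c <=
  N%:R `^ Num.max 0 (1 - c * \sum_(k <- r) invx (p (sigma k))).
Proof.
move=> c0 x1; apply: sum_prod_le => //.
- by move=> k; apply: invx_ge0.
- by move=> k j; exact: mod_ge0 HK _.
- by move=> k; apply: coords_weight.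
Qed.

Let front (i : 'I_n) : seq 'I_n.+1 := [seq widen t | t : 'I_n <- enum 'I_n & (i <= t)%N].

Let big_front (i : 'I_n) (V : Type) (idx : V) (op : Monoid.com_law idx) (F : 'I_n.+1 -> V) :
  \big[op/idx]_(k <- front i) F k = \big[op/idx]_(t < n | (i <= t)%N) F (widen t).
Proof. by rewrite big_map big_filter big_enum_cond. Qed.

(** Each row of the identity has norm at least 1, and the last variable joins the product as one
    more factor. As 1/pm >= 1/2, the resulting exponent is the gap. *)
Lemma test_identity (C : R) (i : 'I_n) N (r : R) :
  (forall A : ('I_n.+1 -> nat -> K) -> K,
    multilinear_form absK p A -> continuous_form absK p A ->
    (mixed_norm (rcons [seq q i | i <- enum 'I_n] (hoelder_conjugate pm))
       (form_coef absK sigma A) <= C%:E * form_norm absK p A)%E) ->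
  0 <= C -> 0 < r -> q i = r%:E -> 2^-1 <= invx pm ->
  N%:R `^ r^-1 <= C * N%:R `^ Num.max 0 (gap (drop i ps) pm).
Proof.
move=> hA C0 r0 qi um.
rewrite -[leLHS]mulr1; apply: (test_form_ineq HK hp hq
  (h := fun j l => (j == l)%:R) hA C0 r0 qi) => // [j jN|x x1].
  apply: le_trans (le_fnorm_coord (j := j) _ _ jN) => //.
  - by rewrite eqxx normr1.
  - by rewrite hoelder_conjugateE// inv_exp_gt0.
have -> : gap (drop i ps) pm =
    1 - 1 * \sum_(k <- ord_max :: front i) invx (p (sigma k)).
  rewrite /gap sum_drop_front_exps big_cons big_front mul1r min_l; lra.
apply: le_trans (prod_bound _ _ ltr01 x1); apply: ler_sum => j _.
rewrite big_cons big_front mulrC !powRr1 ?(mod_ge0 HK)//.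
rewrite (bigD1 j)//= eqxx rmorph1 mul1r big1 ?addr0 => [|l].
  apply: ler_wpM2l; first exact: mod_ge0 HK _.
  by apply: ler_prod => t _; rewrite (mod_ge0 HK) /= powRr1 ?(mod_ge0 HK) ?lexx.
by rewrite -val_eqE eq_sym => /negbTE /= ->; rewrite rmorph0 mul0r.
Qed.

(** Rows have norm N^(1 - u). By Cauchy-Schwarz the form is bounded by the l_2-norm of the front
    product, at most N^(max(0, gap)), times that of the transform, at most N^(1 - u); the common
    factor cancels. *)
Lemma test_sylvester (C : R) (i : 'I_n) m (r : R) :
  (forall A : ('I_n.+1 -> nat -> K) -> K,
    multilinear_form absK p A -> continuous_form absK p A ->
    (mixed_norm (rcons [seq q i | i <- enum 'I_n] (hoelder_conjugate pm))
       (form_coef absK sigma A) <= C%:E * form_norm absK p A)%E) ->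
  0 <= C -> 0 < r -> q i = r%:E -> invx pm <= 2^-1 ->
  (2 ^ m)%:R `^ r^-1 <= C * (2 ^ m)%:R `^ Num.max 0 (gap (drop i ps) pm).
Proof.
move=> hA C0 r0 qi um; set N := (2 ^ m)%N; set u := invx pm in um *.
have N0 : 0 < N%:R :> R by rewrite ltr0n expn_gt0.
have H0 : 0 < N%:R `^ (1 - u) by apply: powR_gt0.
rewrite -(ler_pM2r H0) -mulrA.
apply: (test_form_ineq HK hp hq (h := @sylvester R m) hA C0 r0 qi) => // [j jN|x x1].
- rewrite hoelder_conjugateE// -/u /inv_exp ifT; last lra.
  rewrite /fnorm invrK le_eqVlt; apply/orP; left; apply/eqP; congr (_ `^ _).
  under eq_bigr do rewrite norm_sylvester powR1.
  by rewrite sumr_const card_ord.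
set S := \sum_(k <- front i) invx (p (sigma k)).
have gE : gap (drop i ps) pm = 2^-1 - S.
  rewrite /gap sum_drop_front_exps /S big_front min_r//; rewrite -/u; lra.
apply: cauchy_schwarz_sum => //; first exact: powR_gt0.
- have := prod_bound (front i) N (ltr0n _ 2 : 0 < 2) x1; rewrite -/S.
  (* Using [prod_bound] with [c = 2] yields the square of the bound needed for the front product. *)
  have -> : Num.max 0 (1 - 2 * S) = Num.max 0 (2^-1 - S) * 2.
    rewrite maxr_pMl// mul0r; congr Num.max; lra.
  rewrite powRrM powR_mulrn ?powR_ge0// gE.
  apply: le_trans; apply: ler_sum => j _.
  rewrite big_front -prodrXl le_eqVlt; apply/orP; left; apply/eqP.
  by apply: eq_bigr => t _; rewrite powR_mulrn ?(mod_ge0 HK).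
- rewrite (sylvester_energy HK) -/N.
  have := prod_bound [:: ord_max] N (ltr0n _ 2 : 0 < 2) x1.
  rewrite big_seq1 -/u max_r; last lra.
  under eq_bigr do rewrite big_seq1 powR_mulrn ?(mod_ge0 HK)//.
  move=> h; apply: (@le_trans _ _ (N%:R * N%:R `^ (1 - 2 * u))).
    by rewrite ler_pM2l.
  rewrite -{1}[N%:R]powRr1 ?(ltW N0)// -powRD; last by rewrite (gt_eqF N0) implybT.
  rewrite -powR_mulrn ?powR_ge0// -powRrM le_eqVlt; apply/orP; left; apply/eqP.
  by congr (_ `^ _); lra.
Qed.

(** If [q i] is too small, then 1/r exceeds the positive part [g] of the gap, and N^(1/r) <= C N^g
    fails for large N = 2^m. *)
Lemma exponent_condition_necessary :
  anisotropic_ineq absK sigma q p -> exponent_condition sigma q p.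
Proof.
move=> [C C1 hA]; apply/exponent_conditionE => // i.
rewrite leNgt; apply/negP => qi; have C0 : 0 <= C by lra.
case qE : (q i) (hq i) qi => [r||] //; last by rewrite ltNge leey.
rewrite lte_fin => r0 rg.
pose g := Num.max 0 (gap (drop i ps) pm).
have gr : g < r^-1.
  rewrite gt_max invr_gt0 r0 /=; move: rg; rewrite /inv_exp.
  case: ifPn => [g0|]; last first.
    by rewrite -leNgt => g0 _; apply: le_lt_trans g0 _; rewrite invr_gt0.
  by rewrite lte_fin => rg; rewrite -[ltLHS]invrK ltf_pV2 ?posrE ?invr_gt0.
have [m hm] := @powR_unbounded R (r^-1 - g) C ltac:(by rewrite subr_gt0).
have N0 : 0 < (2 ^ m)%:R :> R by rewrite ltr0n expn_gt0.
have : (2 ^ m)%:R `^ r^-1 <= C * (2 ^ m)%:R `^ g.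
  have [um|um] := leP (2^-1) (invx pm); first exact: test_identity.
  by apply: test_sylvester => //; exact: ltW.
rewrite leNgt => /negP; apply.
rewrite -ltr_pdivlMr ?powR_gt0// -powRN -powRD//.
by rewrite (gt_eqF N0) implybT.
Qed.

Theorem anisotropic_ineqP :
  anisotropic_ineq absK sigma q p <-> exponent_condition sigma q p.
Proof.
split; first exact: exponent_condition_necessary.
exact: (exponent_condition_sufficient HK hp).
Qed.
End NecessityTheorem.

(** * The real and complex moduli, and the equivalence *)

Lemma modulus_real (R : realType) :
  modulus (fun x : R => `|x|) (idfun : {rmorphism R -> R}) idfun (fun=> 0).
Proof.
split=> //=.
- by move=> x y; rewrite normrM.
- by move=> x y; exact: ler_normD.
- move=> x; exists (if 0 <= x then 1 else -1).
    by case: ifP; rewrite ?normrN1 ?normr1.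
  by case: ifPn => x0; [rewrite ger0_norm// mul1r|rewrite ltr0_norm ?ltNge// mulN1r].
- by move=> x y; rewrite addr0.
- by move=> x; rewrite expr0n addr0 real_normK// num_real.
Qed.

Lemma modulus_complex (R : realType) :
  modulus (fun z : R[i] => ComplexField.Normc.normc z)
    (real_complex R : {rmorphism R -> R[i]}) (@complex.Re R) (@complex.Im R).
Proof.
have normE (z : R[i]) : ComplexField.Normc.normc z ^+ 2 =
    complex.Re z ^+ 2 + complex.Im z ^+ 2.
  by case: z => a b; rewrite /= sqr_sqrtr// addr_ge0 ?sqr_ge0.
split=> //=.
- exact: ComplexField.Normc.normcM.
- exact: le_normcD.
- by move=> t; rewrite /ComplexField.Normc.normc /= expr0n addr0 sqrtr_sqr.
- move=> x; have normR (t : R) : ComplexField.Normc.normc (real_complex R t) = `|t|.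
    by rewrite /ComplexField.Normc.normc /= expr0n addr0 sqrtr_sqr.
  have [->|x0] := eqVneq x 0.
    exists 1; first exact: ComplexField.Normc.normc1.
    by rewrite mul1r ComplexField.Normc.normc0 rmorph0.
  exists (real_complex R (ComplexField.Normc.normc x) / x); last by rewrite divfK.
  have nx : ComplexField.Normc.normc x != 0.
    by apply: contra x0 => /eqP/ComplexField.Normc.eq0_normc ->.
  rewrite ComplexField.Normc.normcM ComplexField.Normc.normcV normR.
  by rewrite ger0_norm ?divff//; case: x {x0 nx} => a b; exact: sqrtr_ge0.
- by case=> a b; exact: sqrtr_ge0.
- by case=> a b [c d].
- by case=> a b [c d].
Qed.

Theorem theorem1p1 (R : realType) (n : nat) (hn : (2 <= n.+1)%N)
    (sigma : {perm 'I_n.+1}) (q : 'I_n -> \bar R) (p : 'I_n.+1 -> \bar R)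
    (hq : forall i, (0 < q i)%E) (hp : forall k, (1 <= p k)%E) :
  (anisotropic_ineq (fun x : R => `|x|) sigma q p
     <-> exponent_condition sigma q p) /\
  (anisotropic_ineq (fun z : R[i] => ComplexField.Normc.normc z) sigma q p
     <-> exponent_condition sigma q p).
Proof.
split.
  exact: (anisotropic_ineqP (modulus_real R) sigma hp hq).
exact: (anisotropic_ineqP (modulus_complex R) sigma hp hq).
Qed.
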